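(* Let $U\subset\mathbb R^n$ be bounded and open. There exists a unique differential $n$-chain $\widetilde U\in\hat{\mathcal B}_n^1$ such that $\int_{\widetilde U}\omega=\int_U\omega$ for all $\omega\in\mathcal B_n^1$, where the integral on the right hand side is the Riemann integral.
   Context: Fix the standard inner product on $\mathbb R^n$, extended to $k$-vectors by $\langle u_1\wedge\dots\wedge u_k,v_1\wedge\dots\wedge v_k\rangle=\det(\langle u_i,v_j\rangle)$. A simple $k$-vector has mass $\|\alpha\|=\sqrt{\langle\alpha,\alpha\rangle}$; a general one has mass $\|\alpha\|=\inf\{\sum\|\alpha_j\|:\alpha=\sum\alpha_j,\ \alpha_j \text{ simple}\}$. $\mathcal A_k$ is the space of Dirac $k$-chains: finite formal sums $\sum(p_i;\alpha_i)$, $p_i\in\mathbb R^n$, $\alpha_i\in\Lambda_k(\mathbb R^n)$ (finitely supported functions $\mathbb R^n\to\Lambda_k(\mathbb R^n)$). With $\Delta_u(p;\alpha)=(p+u;\alpha)-(p;\alpha)$, the $B^1$ norm is $\|A\|_{B^1}=\inf\{\sum_i\|\alpha_i\|+\sum_j\|u_j\|\|\beta_j\|: A=\sum_i(p_i;\alpha_i)+\sum_j\Delta_{u_j}(q_j;\beta_j)\}$ (finite sums); $\hat{\mathcal B}_k^1$ is the completion of $\mathcal A_k$ in this norm. A $k$-form is a linear functional $\omega$ on $\mathcal A_k$; $\mathcal B_k^1$ is the space of $k$-forms with $\sup\{|\omega(p;\alpha)|:\|\alpha\|=1\}<\infty$ and $\sup\{|\omega(\Delta_u(p;\alpha))|:\|u\|\|\alpha\|=1\}<\infty$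 (bounded Lipschitz $k$-forms). For $J\in\hat{\mathcal B}_k^1$, $\omega\in\mathcal B_k^1$: $\int_J\omega=\lim\omega(A_i)$ for Dirac chains $A_i\to J$ in the $B^1$ norm. For $\omega\in\mathcal B_n^1$, written $\omega=f\,dx_1\wedge\dots\wedge dx_n$, $\int_U\omega=\int_Uf\,dx$ is the Riemann integral over the open set $U$, taken as the sum of the Riemann integrals over the cubes of a Whitney decomposition of $U$ into non-overlapping cubes. *)

(* Defs.v *)
From HB Require Import structures.
From mathcomp Require Import all_boot all_order all_algebra.
From mathcomp Require Import fingroup perm generic_quotient ring_quotient.
From mathcomp Require Import all_classical all_reals all_analysis.
From mathcomp Require Import ring lra.
Import numFieldNormedType.Exports.
Set Implicit Arguments.
Unset Strict Implicit.
Unset Printing Implicit Defensive.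
Import Order.TTheory GRing.Theory Num.Theory.
Local Open Scope classical_set_scope.
Local Open Scope ring_scope.

Section Euclid.
Variables (R : realType) (n : nat).

(* The library norm on 'rV[R]_n is the sup norm, hence this one. *)
Definition enorm (u : 'rV[R]_n) : R := Num.sqrt ((u *m u^T) 0 0).

End Euclid.

Section KVectors.
Variables (R : realType) (n k : nat).

Definition multi_index := {I : {set 'I_n} | #|I| == k}.

(* Coordinates on the basis e_I = e_i1 /\ ... /\ e_ik, I = {i1 < ... < ik}. *)
Definition kvector := {ffun multi_index -> R^o}.
HB.instance Definition _ := GRing.Lmodule.on kvector.
HB.instance Definition _ := Choice.on kvector.

Definition mi_nth (I : multi_index) (j : 'I_k) : 'I_n :=
  enum_val (cast_ord (esym (eqP (valP I))) j).

(* [wedge_rows u] is u_1 /\ ... /\ u_k for the rows u_i of u. *)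
Definition wedge_rows (u : 'M[R]_(k, n)) : kvector :=
  [ffun I => \det (colsub (mi_nth I) u)].

(* The inner product with orthonormal basis (e_I); [kinner_wedge_rows] below
   identifies it with det (<u_i, v_j>) on u_1 /\ ... /\ u_k, v_1 /\ ... /\ v_k. *)
Definition kinner (a b : kvector) : R := \sum_I a I * b I.

(* The scalar only matters for k = 0, where the empty wedge product is 1. *)
Definition simple_kvector (a : kvector) : Prop :=
  exists (c : R) (u : 'M[R]_(k, n)), a = c *: wedge_rows u.

Definition simple_mass (a : kvector) : R := Num.sqrt (kinner a a).

(* For simple a this equals [simple_mass a], see [mass_simple]. *)
Definition mass (a : kvector) : R :=
  inf [set \sum_(b <- s) simple_mass b | s in
        [set s : seq kvector | {in s, forall b, simple_kvector b} /\
                               a = \sum_(b <- s) b]].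

End KVectors.

Section DiracChains.
Variables (R : realType) (n k : nat).

Definition finsupp_chain : {pred 'rV[R]_n -> kvector R n k} :=
  [pred A | `[< finite_set [set p | A p != 0] >]].

Lemma finsupp_chain_submod : submod_closed finsupp_chain.
Proof.
split=> [|c A B /asboolP fA /asboolP fB].
  apply/asboolP; rewrite (_ : [set _ | _] = set0) //.
  by apply/seteqP; split=> // p /=; rewrite eqxx.
apply/asboolP; apply: (@sub_finite_set _ _
  ([set p | A p != 0] `|` [set p | B p != 0])); last by rewrite finite_setU.
move=> p /= h; apply: contrapT => /not_orP[/negP/negPn/eqP A0 /negP/negPn/eqP B0].
by move: h; rewrite !fctE A0 B0 scaler0 addr0 eqxx.
Qed.
HB.instance Definition _ :=
  GRing.isSubmodClosed.Build R _ finsupp_chain finsupp_chain_submod.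

Record dirac_chain := DiracChain {
  chain_val :> 'rV[R]_n -> kvector R n k;
  _ : chain_val \in finsupp_chain }.

HB.instance Definition _ := [isSub for chain_val].
HB.instance Definition _ := [Choice of dirac_chain by <:].
HB.instance Definition _ := [SubChoice_isSubLmodule of dirac_chain by <:].

(* [elementary p a] is the chain (p; a). *)
Definition elementary_fun (p : 'rV[R]_n) (a : kvector R n k) :
  'rV[R]_n -> kvector R n k := fun q => if q == p then a else 0.

Lemma elementary_subproof p a : elementary_fun p a \in finsupp_chain.
Proof.
apply/asboolP; apply: (@sub_finite_set _ _ [set p]) => // q /=.
by rewrite /elementary_fun; case: ifP => [/eqP //|_]; rewrite eqxx.
Qed.

Definition elementary p a : dirac_chain := DiracChain (elementary_subproof p a).

Definition translate_diff (u p : 'rV[R]_n) (a : kvector R n k) : dirac_chain :=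
  elementary (p + u) a - elementary p a.

End DiracChains.

Section MassTheory.
Variables (R : realType) (n k : nat).
Implicit Types a b : kvector R n k.

Lemma kinnerC a b : kinner a b = kinner b a.
Proof. by apply: eq_bigr => I _; rewrite mulrC. Qed.

Lemma kinnerDl a b c : kinner (a + b) c = kinner a c + kinner b c.
Proof.
by rewrite /kinner -big_split /=; apply: eq_bigr => I _; rewrite ffunE mulrDl.
Qed.

Lemma kinnerZl (x : R) a b : kinner (x *: a) b = x * kinner a b.
Proof.
by rewrite /kinner mulr_sumr; apply: eq_bigr => I _; rewrite ffunE -scalerAl.
Qed.

Lemma kinner_ge0 a : 0 <= kinner a a.
Proof. by apply: sumr_ge0 => I _; rewrite -expr2 sqr_ge0. Qed.

Lemma kinner0_eq0 a : kinner a a = 0 -> a = 0.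
Proof.
move=> /eqP; rewrite psumr_eq0 => [/allP a0|I _]; last by rewrite -expr2 sqr_ge0.
apply/ffunP => I; rewrite ffunE; have := a0 I (mem_index_enum _).
by rewrite -expr2 sqrf_eq0 => /eqP.
Qed.

Lemma simple_mass0 : simple_mass (0 : kvector R n k) = 0.
Proof. by rewrite /simple_mass -(scale0r 0) kinnerZl mul0r sqrtr0. Qed.

Lemma simple_massZ (x : R) a : simple_mass (x *: a) = `|x| * simple_mass a.
Proof.
rewrite /simple_mass kinnerZl kinnerC kinnerZl mulrA -expr2.
by rewrite sqrtrM ?sqr_ge0 // sqrtr_sqr.
Qed.

Lemma kinner_le a b : kinner a b <= simple_mass a * simple_mass b.
Proof.
have ss (c : kvector R n k) : simple_mass c ^+ 2 = kinner c c.
  by rewrite sqr_sqrtr ?kinner_ge0.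
have s0 (c : kvector R n k) : simple_mass c = 0 -> c = 0.
  by move=> c0; apply: kinner0_eq0; rewrite -ss c0 expr0n.
have [/s0 a0|an0] := eqVneq (simple_mass a) 0.
  by rewrite a0 -(scale0r 0) kinnerZl mul0r scale0r simple_mass0 mul0r.
have [/s0 b0|bn0] := eqVneq (simple_mass b) 0.
  by rewrite b0 kinnerC -(scale0r 0) kinnerZl mul0r scale0r simple_mass0 mulr0.
have AB0 : 0 < simple_mass a * simple_mass b.
  by rewrite mulr_gt0 // lt_neqAle eq_sym ?an0 ?bn0 sqrtr_ge0.
rewrite -(ler_pM2l AB0) -subr_ge0.
have := kinner_ge0 (simple_mass b *: a + (- simple_mass a) *: b).
rewrite kinnerDl !kinnerZl kinnerC (kinnerC b) !kinnerDl !kinnerZl -!ss (kinnerC b a).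
set A := simple_mass a; set B := simple_mass b; set C := kinner a b => H.
rewrite -(@pmulr_lge0 _ 2) //; apply: le_trans H _; lra.
Qed.

Lemma simple_massD a b : simple_mass (a + b) <= simple_mass a + simple_mass b.
Proof.
rewrite -(@ler_pXn2r _ 2) ?nnegrE ?addr_ge0 ?sqrtr_ge0 //.
rewrite sqrrD !sqr_sqrtr ?kinner_ge0 // kinnerDl (kinnerC a) (kinnerC b) !kinnerDl.
by rewrite (kinnerC b a); have := kinner_le a b; lra.
Qed.

Lemma simple_mass_sum (s : seq (kvector R n k)) :
  simple_mass (\sum_(b <- s) b) <= \sum_(b <- s) simple_mass b.
Proof.
elim: s => [|b s IH]; first by rewrite !big_nil simple_mass0.
by rewrite !big_cons (le_trans (simple_massD _ _)) ?lerD2l.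
Qed.

Let decomp a := [set s : seq (kvector R n k) |
  {in s, forall b, simple_kvector b} /\ a = \sum_(b <- s) b].

Lemma simple_kvectorZ (x : R) a : simple_kvector a -> simple_kvector (x *: a).
Proof. by move=> [c [u ->]]; exists (x * c), u; rewrite scalerA. Qed.

Lemma mi_nth_inj (I : multi_index n k) : injective (mi_nth I).
Proof. by move=> i j /enum_val_inj /cast_ord_inj. Qed.

Lemma mem_mi_nth (I : multi_index n k) i : mi_nth I i \in val I.
Proof. exact: enum_valP. Qed.

Lemma wedge_rows_basis (I : multi_index n k) :
  wedge_rows (\matrix_(i, j) (mi_nth I i == j)%:R) =
  [ffun J => (J == I)%:R] :> kvector R n k.
Proof.
apply/ffunP => J; rewrite !ffunE; case: eqVneq => [->|JI].
  rewrite (_ : colsub _ _ = 1%:M) ?det1 //; apply/matrixP => i j.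
  by rewrite !mxE (inj_eq (@mi_nth_inj I)).
have [i Hi] : exists i, mi_nth I i \notin val J.
  apply: contrapT => /forallNP H; move/eqP: JI; apply; apply/val_inj/eqP.
  rewrite eq_sym eqEcard (eqP (valP I)) (eqP (valP J)) leqnn andbT.
  apply/fintype.subsetP => x xI; have := H (cast_ord (eqP (valP I)) (enum_rank_in xI x)).
  by move=> /negP; rewrite negbK /mi_nth cast_ordK enum_rankK_in.
rewrite (expand_det_row _ i) big1 // => j _; rewrite !mxE.
case: eqP => [E|]; last by rewrite mul0r.
by rewrite E mem_mi_nth in Hi.
Qed.

Lemma decomp_nonempty a : decomp a !=set0.
Proof.
exists [seq a L *: wedge_rows (\matrix_(i, j) (mi_nth L i == j)%:R) | L <- index_enum _].
split; first by move=> _ /mapP[I _ ->]; exists (a I), (\matrix_(i, j) (mi_nth I i == j)%:R).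
rewrite big_map; apply/ffunP => J; rewrite sum_ffunE (bigD1 J) //= big1 => [|I /negbTE IJ].
  by rewrite wedge_rows_basis !ffunE eqxx addr0 /GRing.scale /= mulr1.
by rewrite wedge_rows_basis !ffunE eq_sym IJ scaler0.
Qed.

Lemma mass_le a (s : seq (kvector R n k)) : {in s, forall b, simple_kvector b} ->
  a = \sum_(b <- s) b -> mass a <= \sum_(b <- s) simple_mass b.
Proof.
move=> ss Ea; apply: ge_inf; last by exists s.
by exists 0 => _ [t _ <-]; rewrite sumr_ge0 // => *; rewrite sqrtr_ge0.
Qed.

Lemma le_mass a (x : R) : (forall s, {in s, forall b, simple_kvector b} ->
    a = \sum_(b <- s) b -> x <= \sum_(b <- s) simple_mass b) -> x <= mass a.
Proof.
move=> H; apply: lb_le_inf => [|_ [s [ss Ea] <-]]; last exact: H.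
by have [s Hs] := decomp_nonempty a; exists (\sum_(b <- s) simple_mass b); exists s.
Qed.

Lemma simple_mass_le a : simple_mass a <= mass a.
Proof. by apply: le_mass => s _ ->; exact: simple_mass_sum. Qed.

Lemma mass_simple a : simple_kvector a -> mass a = simple_mass a.
Proof.
move=> sa; apply/eqP; rewrite eq_le simple_mass_le andbT.
rewrite (le_trans (@mass_le _ [:: a] _ _)) ?big_seq1 // => b.
by rewrite inE => /eqP ->.
Qed.

Lemma mass_ge0 a : 0 <= mass a.
Proof. exact: le_trans (sqrtr_ge0 _) (simple_mass_le a). Qed.

Lemma mass0_eq0 a : mass a = 0 -> a = 0.
Proof.
move=> a0; have : simple_mass a <= 0 by rewrite -a0 simple_mass_le.
rewrite /simple_mass leNgt sqrtr_gt0 -leNgt => a1.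
by apply/kinner0_eq0/eqP; rewrite eq_le a1 kinner_ge0.
Qed.

Lemma massZ (x : R) a : mass (x *: a) = `|x| * mass a.
Proof.
have H (y : R) b : `|y| * mass b >= mass (y *: b).
  have [->|y0] := eqVneq y 0.
    rewrite scale0r normr0 mul0r (le_trans (@mass_le _ [::] _ _)) ?big_nil //.
  rewrite mulrC -ler_pdivrMr ?normr_gt0 //; apply: le_mass => s ss ->.
  rewrite ler_pdivrMr ?normr_gt0 // mulrC scaler_sumr mulr_sumr.
  under [in leRHS]eq_bigr do rewrite -simple_massZ.
  rewrite -(big_map ( *:%R y) predT (fun a => simple_mass a)).
  apply: mass_le; last by rewrite big_map.
  by move=> _ /mapP[c /ss sc ->]; exact: simple_kvectorZ.
apply/eqP; rewrite eq_le H /=; have [->|x0] := eqVneq x 0.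
  by rewrite normr0 mul0r mass_ge0.
rewrite mulrC -ler_pdivlMr ?normr_gt0 // mulrC -normfV.
by rewrite (le_trans _ (H _ _)) // scalerA mulVf // scale1r.
Qed.

Lemma massD a b : mass (a + b) <= mass a + mass b.
Proof.
rewrite -lerBlDr; apply: le_mass => s ss Ea.
rewrite lerBlDl -lerBlDr; apply: le_mass => t st Eb.
rewrite lerBlDr -big_cat; apply: mass_le; last by rewrite big_cat -Ea -Eb addrC.
by move=> c; rewrite mem_cat => /orP[/st|/ss].
Qed.

End MassTheory.

Section CauchyBinet.
Variables (R : realType) (n k : nat).
Implicit Types u v : 'M[R]_(k, n).

Lemma mi_nth_surj (I : multi_index n k) x : x \in val I -> exists j, mi_nth I j = x.
Proof.
move=> xI; exists (cast_ord (eqP (valP I)) (enum_rank_in xI x)).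
by rewrite /mi_nth cast_ordK enum_rankK_in.
Qed.

Let h (x : multi_index n k * 'S_k) : {ffun 'I_k -> 'I_n} :=
  [ffun i => mi_nth x.1 (x.2 i)].

Let h_inj : injective h.
Proof.
have sub x y : h x = h y -> val x.1 \subset val y.1.
  move=> /ffunP E; apply/fintype.subsetP => z /mi_nth_surj[j <-].
  by have := E ((x.2^-1)%g j); rewrite !ffunE permKV => ->; exact: mem_mi_nth.
move=> [I s] [J t] E.
have EIJ : I = J.
  by apply/val_inj/eqP; rewrite finset.eqEsubset (sub _ _ E) (sub _ _ (esym E)).
rewrite -{}EIJ in E *; congr pair; apply/permP => i.
by move/ffunP: E => /(_ i); rewrite !ffunE => /mi_nth_inj.
Qed.

Let h_surj (f : {ffun 'I_k -> 'I_n}) : injectiveb f -> exists x, h x = f.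
Proof.
move=> /injectiveP fi.
have cI : #|imset f (mem 'I_k)| == k by rewrite card_imset // card_ord.
pose I : multi_index n k := Sub (imset f (mem 'I_k)) cI.
have /choice[g gE] i : exists j, mi_nth I j = f i.
  by apply: mi_nth_surj; rewrite imset_f.
have gi : injective g by move=> i j /(congr1 (mi_nth I)); rewrite !gE => /fi.
by exists (I, perm gi); apply/ffunP => i; rewrite ffunE permE gE.
Qed.

Lemma kinner_wedge_rows u v : kinner (wedge_rows u) (wedge_rows v) = \det (u *m v^T).
Proof.
pose F (f : {ffun 'I_k -> 'I_n}) := \det (\matrix_(i, j) v j (f i)) * \prod_i u i (f i).
transitivity (\sum_f F f); last first.
  pose AB (s : 'S_k) i j := u i j * v (s i) j.
  transitivity (\sum_(f : {ffun 'I_k -> 'I_n}) \sum_(s : 'S_k)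
      (-1) ^+ s * \prod_i AB s i (f i)).
    apply: eq_bigr => f _; rewrite /F mulrC big_distrr /=; apply: eq_bigr => s _.
    rewrite mulrCA /AB big_split //=; congr (_ * (_ * _)).
    by apply: eq_bigr => i _; rewrite mxE.
  rewrite exchange_big; apply: eq_bigr => /= s _; rewrite -big_distrr /=.
  congr (_ * _); rewrite -(bigA_distr_bigA (AB s)) /=.
  by apply: eq_bigr => i _; rewrite mxE; apply: eq_bigr => j _; rewrite mxE.
rewrite (bigID (fun f : {ffun _} => injectiveb f)) /= addrC big1 ?add0r; last first.
  move=> f /injectivePn[i1 [i2 Di12 Ef12]].
  by rewrite /F (determinant_alternate Di12) ?mul0r // => j; rewrite !mxE Ef12.
have hP x : injectiveb (h x).
  by apply/injectiveP => i j; rewrite !ffunE => /mi_nth_inj/perm_inj.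
have [x0|no_x] := pselect (exists x0 : multi_index n k * 'S_k, True); last first.
  rewrite /kinner !big1 // => [f fi|I _]; exfalso; apply: no_x.
    by have [x _] := h_surj fi; exists x.
  by exists (I, 1%g).
rewrite (reindex h) /=; last first.
  have /choice[h' h'P] (f : {ffun _}) : exists x, injectiveb f -> h x = f.
    by have [/h_surj[x <-]|nf] := boolP (injectiveb f); [exists x|case: x0 => x; exists x].
  by exists h' => [x _|f /h'P //]; apply: h_inj; rewrite h'P.
rewrite (eq_bigl xpredT) // -(pair_bigA _ (fun I s => F (h (I, s)))) /=.
apply: eq_bigr => I _; rewrite !ffunE mulrC -[\det (colsub _ v)]det_tr big_distrr /=.
apply: eq_bigr => s _; rewrite /F mulrA; congr (_ * _); last first.
  by apply: eq_bigr => i _; rewrite !mxE ffunE.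
rewrite mulrC -det_perm -det_mulmx -row_permE; congr (\det _).
by apply/matrixP => i j; rewrite !mxE ffunE.
Qed.

End CauchyBinet.

Section B1Norm.
Variables (R : realType) (n k : nat).
Implicit Types A B : dirac_chain R n k.

Lemma elementary_is_linear (p : 'rV[R]_n) : linear (@elementary R n k p).
Proof.
move=> c a b; apply/val_inj/funext => q /=.
by rewrite /elementary_fun !fctE /=; case: ifP => // _; rewrite scaler0 addr0.
Qed.
HB.instance Definition _ p := GRing.isLinear.Build R _ _ _ (@elementary R n k p)
  (elementary_is_linear p).

(* Formal data of an expression
   sum_i (p_i; a_i) + sum_j Delta_(u_j) (q_j; b_j). *)
Definition B1_expr : Type :=
  seq ('rV[R]_n * kvector R n k) * seq ('rV[R]_n * 'rV[R]_n * kvector R n k).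

Definition B1_chain (E : B1_expr) : dirac_chain R n k :=
  \sum_(x <- E.1) elementary x.1 x.2 +
  \sum_(y <- E.2) translate_diff y.1.1 y.1.2 y.2.

Definition B1_cost (E : B1_expr) : R :=
  \sum_(x <- E.1) mass x.2 + \sum_(y <- E.2) enorm y.1.1 * mass y.2.

Definition B1_norm A : R := inf [set B1_cost E | E in [set E | A = B1_chain E]].

Lemma B1_cost_ge0 E : 0 <= B1_cost E.
Proof.
by rewrite addr_ge0 ?sumr_ge0 // => *; rewrite ?mulr_ge0 ?mass_ge0 ?sqrtr_ge0.
Qed.

Lemma dirac_chainE A : exists E, A = B1_chain E.
Proof.
have /asboolP fA := valP A.
pose s : seq 'rV[R]_n := finmap.enum_fset (fset_set [set p | A p != 0]).
exists ([seq (p, A p) | p <- s], [::]).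
rewrite /B1_chain big_nil addr0 big_map; apply/val_inj/funext => q /=.
have -> : val (\sum_(p <- s) elementary p (A p)) =
    \sum_(p <- s) elementary_fun p (A p).
  by elim/big_rec2: _ => // p _ x _ <-.
rewrite fct_sumE /elementary_fun.
have [qs|qs] := boolP (q \in s).
  rewrite (bigD1_seq q) ?finmap.fset_uniq //= eqxx big1 ?addr0 // => p.
  by rewrite eq_sym => /negbTE ->.
rewrite big_seq big1 => [|p ps]; last by case: eqP => // qp; rewrite qp ps in qs.
move: qs; rewrite in_fset_set // notin_setE /=.
by move/negP; rewrite negbK => /eqP ->.
Qed.

Lemma B1_norm_le E : B1_norm (B1_chain E) <= B1_cost E.
Proof.
apply: ge_inf; last by exists E.
by exists 0 => _ [F _ <-]; exact: B1_cost_ge0.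
Qed.

Lemma le_B1_norm A (x : R) :
  (forall E, A = B1_chain E -> x <= B1_cost E) -> x <= B1_norm A.
Proof.
move=> H; apply: lb_le_inf => [|_ [E EA <-]]; last exact: H.
by have [E EA] := dirac_chainE A; exists (B1_cost E); exists E.
Qed.

Lemma B1_norm_ge0 A : 0 <= B1_norm A.
Proof. by apply: le_B1_norm => E _; exact: B1_cost_ge0. Qed.

Lemma B1_normD A B : B1_norm (A + B) <= B1_norm A + B1_norm B.
Proof.
rewrite -lerBlDr; apply: le_B1_norm => E ->.
rewrite lerBlDl -lerBlDr; apply: le_B1_norm => F ->; rewrite lerBlDr.
have -> : B1_chain E + B1_chain F = B1_chain (E.1 ++ F.1, E.2 ++ F.2).
  by rewrite /B1_chain !big_cat addrACA.
by apply: le_trans (B1_norm_le _) _; rewrite /B1_cost !big_cat /= addrACA addrC.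
Qed.

Lemma B1_normZ (c : R) A : B1_norm (c *: A) = `|c| * B1_norm A.
Proof.
have H (d : R) B : B1_norm (d *: B) <= `|d| * B1_norm B.
  have [->|d0] := eqVneq d 0.
    rewrite scale0r normr0 mul0r.
    have -> : 0 = B1_chain ([::], [::]) by rewrite /B1_chain !big_nil addr0.
    by apply: le_trans (B1_norm_le _) _; rewrite /B1_cost !big_nil addr0.
  rewrite mulrC -ler_pdivrMr ?normr_gt0 //; apply: le_B1_norm => E ->.
  rewrite ler_pdivrMr ?normr_gt0 // mulrC.
  have -> : d *: B1_chain E =
    B1_chain ([seq (x.1, d *: x.2) | x <- E.1], [seq (y.1, d *: y.2) | y <- E.2]).
    rewrite /B1_chain !big_map scalerDr !scaler_sumr; congr (_ + _).
      by apply: eq_bigr => x _; rewrite linearZ.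
    by apply: eq_bigr => y _; rewrite /translate_diff scalerBr -!linearZ.
  apply: le_trans (B1_norm_le _) _.
  rewrite /B1_cost !big_map mulrDr !mulr_sumr lerD //; apply: ler_sum => x _.
    by rewrite massZ.
  by rewrite massZ mulrCA.
apply/eqP; rewrite eq_le H /=; have [->|c0] := eqVneq c 0.
  by rewrite normr0 mul0r B1_norm_ge0.
rewrite mulrC -ler_pdivlMr ?normr_gt0 // mulrC -normfV.
by rewrite (le_trans _ (H _ _)) // scalerA mulVf // scale1r.
Qed.

Lemma B1_normMn A m : B1_norm (A *+ m) = B1_norm A *+ m.
Proof. by rewrite -scaler_nat B1_normZ normr_nat mulr_natl. Qed.

Lemma B1_normN A : B1_norm (- A) = B1_norm A.
Proof. by rewrite -scaleN1r B1_normZ normrN1 mul1r. Qed.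

HB.instance Definition _ := Num.Zmodule_isSemiNormed.Build R (dirac_chain R n k)
  B1_normD B1_normMn B1_normN.

End B1Norm.

Section Completion.
Variables (R : realType) (V : semiNormedZmodType R).
Implicit Types u v : nat -> V.

Definition is_cauchy u : Prop := forall e : R, 0 < e ->
  exists N, forall i j, (N <= i)%N -> (N <= j)%N -> `|u i - u j| < e.

Definition cauchy_pred : {pred nat -> V} := [pred u | `[< is_cauchy u >]].

Lemma cauchy_pred_zmod : zmod_closed cauchy_pred.
Proof.
split=> [|u v /asboolP cu /asboolP cv]; apply/asboolP => e e0.
  by exists 0%N => i j _ _; rewrite subrr normr0.
have e2 : 0 < e / 2 by rewrite divr_gt0.
have [N HN] := cu _ e2; have [M HM] := cv _ e2.
exists (maxn N M) => i j; rewrite !geq_max => /andP[Ni Mi] /andP[Nj Mj].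
rewrite !fctE opprD addrACA -opprD [e]splitr.
by rewrite (le_lt_trans (ler_normD _ _)) // normrN ltrD ?HN ?HM.
Qed.
HB.instance Definition _ :=
  GRing.isZmodClosed.Build (nat -> V) cauchy_pred cauchy_pred_zmod.

Record cauchy_seq := CauchySeq {
  cauchy_val :> nat -> V;
  _ : cauchy_val \in cauchy_pred }.

HB.instance Definition _ := [isSub for cauchy_val].
HB.instance Definition _ := [Choice of cauchy_seq by <:].
HB.instance Definition _ := [SubChoice_isSubZmodule of cauchy_seq by <:].

Definition null_pred : {pred cauchy_seq} :=
  [pred u : cauchy_seq | `[< `|u i| @[i --> \oo] --> (0 : R) >]].

Lemma null_pred_zmod : zmod_closed null_pred.
Proof.
split=> [|u v /asboolP cu /asboolP cv]; apply/asboolP.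
  rewrite (_ : (fun i => _) = fun=> 0); first exact: cvg_cst.
  by apply/funext => i; rewrite normr0.
apply: (@squeeze_cvgr _ _ _ _ (fun=> 0) (fun i => `|u i| + `|v i|)).
- apply: nearW => i; rewrite normr_ge0 /=.
  by rewrite (le_trans (ler_normD _ _)) // normrN.
- exact: cvg_cst.
- by rewrite -[X in _ --> X]addr0; exact: cvgD.
Qed.
HB.instance Definition _ :=
  GRing.isZmodClosed.Build cauchy_seq null_pred null_pred_zmod.

Definition completion : Type := Quotient.quot null_pred.
HB.instance Definition _ := GRing.Zmodule.on completion.
HB.instance Definition _ := Quotient.on completion.

Definition cauchy_class (u : cauchy_seq) : completion := \pi_completion%qT u.

Lemma cauchy_class_eqP (u v : cauchy_seq) :
  cauchy_class u = cauchy_class v <-> `|u i - v i| @[i --> \oo] --> (0 : R).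
Proof.
split=> [/eqP|uv].
  by rewrite -Quotient.idealrBE => /asboolP.
by apply/eqP; rewrite -Quotient.idealrBE; apply/asboolP.
Qed.

Lemma cauchy_class_repr (x : completion) : cauchy_class (repr x) = x.
Proof. exact: reprK. Qed.

Lemma cauchy_classB (u v : cauchy_seq) : cauchy_class (u - v) = cauchy_class u - cauchy_class v.
Proof. by rewrite /cauchy_class !piE. Qed.

Lemma cauchy_classD (u v : cauchy_seq) : cauchy_class (u + v) = cauchy_class u + cauchy_class v.
Proof. by rewrite /cauchy_class !piE. Qed.

Lemma seminorm_dist (a b : V) : `| `|a| - `|b| | <= `|a - b|.
Proof.
have := ler_normD (a - b) b; have := ler_normD (b - a) a.
by rewrite !subrK distrC ler_norml => *; apply/andP; split; lra.
Qed.

Lemma cauchy_norm_cvg (u : cauchy_seq) : cvgn (fun i => `|u i|).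
Proof.
apply: cauchy_cvg; apply/cauchy_ballP => e e0.
have /asboolP/(_ e e0)[N HN] := valP u.
exists ((fun i => `|u i|) @` [set i | (N <= i)%N], (fun i => `|u i|) @` [set i | (N <= i)%N]).
  by split; exists N => // i /= Ni; exists i.
move=> [_ _] [[i Ni <-] [j Nj <-]] /=.
by rewrite /ball /= (le_lt_trans (seminorm_dist _ _)) // HN.
Qed.

(* The norm of the class of u is lim |u_i|. *)
Definition completion_norm (x : completion) : R := limn (fun i => `|repr x i|).

Lemma completion_norm_cvg (u : cauchy_seq) :
  `|u i| @[i --> \oo] --> completion_norm (cauchy_class u).
Proof.
have /cauchy_class_eqP ur := cauchy_class_repr (cauchy_class u).
have := @cauchy_norm_cvg (repr (cauchy_class u)).
rewrite /completion_norm; set r := repr _ in ur * => cr.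
have H : (`|u i| - `|r i|) @[i --> \oo] --> (0 : R).
  apply/norm_cvg0P; apply: (@squeeze_cvgr _ _ _ _ (fun=> 0) (fun i => `|r i - u i|)) => //.
    by apply: nearW => i; rewrite normr_ge0 distrC seminorm_dist.
  exact: cvg_cst.
rewrite (_ : (fun i => _) = (fun i => (`|u i| - `|r i|) + `|r i|)); last first.
  by apply/funext => i; rewrite subrK.
by rewrite -[X in _ --> X]add0r; exact: cvgD.
Qed.

Lemma completion_norm_le (u : cauchy_seq) (x : R) :
  (forall i, `|u i| <= x) -> completion_norm (cauchy_class u) <= x.
Proof.
move=> ux; rewrite -(cvg_lim _ (@completion_norm_cvg u)) //.
by apply: limr_le; [exact: cauchy_norm_cvg|exact: nearW].
Qed.

Lemma completion_normD x y :
  completion_norm (x + y) <= completion_norm x + completion_norm y.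
Proof.
rewrite -[x]cauchy_class_repr -[y]cauchy_class_repr -cauchy_classD.
have cD : (`|repr x i| + `|repr y i|) @[i --> \oo] -->
    completion_norm (cauchy_class (repr x)) + completion_norm (cauchy_class (repr y)).
  by apply: cvgD; exact: completion_norm_cvg.
rewrite -(cvg_lim _ (@completion_norm_cvg (repr x + repr y))) // -(cvg_lim _ cD) //.
apply: ler_lim; [exact: cauchy_norm_cvg|by apply/cvg_ex; eexists; exact: cD|].
by apply: nearW => i; rewrite ler_normD.
Qed.

Lemma completion_norm0_eq0 x : completion_norm x = 0 -> x = 0.
Proof.
move=> x0; rewrite -[x]cauchy_class_repr -(subrr (cauchy_class 0)) -cauchy_classB.
apply/cauchy_class_eqP; rewrite subrr.
rewrite (_ : (fun i => _) = fun i => `|repr x i|); last first.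
  by apply/funext => i; rewrite subr0.
by rewrite -x0 -{2}[x]cauchy_class_repr; exact: completion_norm_cvg.
Qed.

Lemma completion_normMn x m : completion_norm (x *+ m) = completion_norm x *+ m.
Proof.
have -> : x *+ m = cauchy_class (repr x *+ m).
  elim: m => [|m IH]; first by rewrite !mulr0n -(subrr (repr x)) cauchy_classB subrr.
  by rewrite !mulrS cauchy_classD -IH cauchy_class_repr.
apply: (cvg_unique _ (@completion_norm_cvg _)) => //.
rewrite (_ : (fun i => _) = fun i => `|repr x i| *+ m); last first.
  apply/funext => i; rewrite -normrMn; congr `|_|.
  by elim: m => // m IH; rewrite !mulrS -IH.
by apply: cvgMn; rewrite -{2}[x]cauchy_class_repr; exact: completion_norm_cvg.
Qed.

Lemma completion_normN x : completion_norm (- x) = completion_norm x.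
Proof.
have -> : - x = cauchy_class (0 - repr x).
  by rewrite cauchy_classB cauchy_class_repr -(subrr 0) cauchy_classB subrr sub0r.
apply: (cvg_unique _ (@completion_norm_cvg _)) => //.
rewrite (_ : (fun i => _) = fun i => `|repr x i|); last first.
  by apply/funext => i; rewrite sub0r normrN.
by rewrite -{2}[x]cauchy_class_repr; exact: completion_norm_cvg.
Qed.

HB.instance Definition _ := Num.Zmodule_isNormed.Build R completion
  completion_normD completion_norm0_eq0 completion_normMn completion_normN.

Lemma cst_is_cauchy (a : V) : (fun=> a) \in cauchy_pred.
Proof. by apply/asboolP => e e0; exists 0%N => i j _ _; rewrite subrr normr0. Qed.

Definition to_completion (a : V) : completion :=
  cauchy_class (CauchySeq (cst_is_cauchy a)).

Lemma to_completionB a b : to_completion (a - b) = to_completion a - to_completion b.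
Proof.
by rewrite /to_completion -cauchy_classB; congr cauchy_class; exact/val_inj.
Qed.

Lemma to_completion_norm a : `|to_completion a| = `|a|.
Proof.
rewrite -[LHS]/(completion_norm _).
rewrite -(cvg_lim _ (@completion_norm_cvg _)) //.
by apply: lim_near_cst => //; exact: nearW.
Qed.

Lemma to_completion_cvg (u : cauchy_seq) :
  `|to_completion (u i) - cauchy_class u| @[i --> \oo] --> (0 : R).
Proof.
apply/cvgrPdist_lt => e e0; have /asboolP/(_ (e / 2)) := valP u.
rewrite divr_gt0 // => /(_ erefl)[N HN]; exists N => // i /= Ni.
rewrite sub0r normrN normr_id -cauchy_classB.
have H j : (N <= j)%N -> `|u i - u j| <= e / 2 by move=> Nj; exact/ltW/HN.
apply: (@le_lt_trans _ _ (e / 2)); last by rewrite ltr_pdivrMr // ltr_pMr // ltr1n.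
rewrite -[leLHS]/(completion_norm _) -(cvg_lim _ (@completion_norm_cvg _)) //.
by apply: limr_le; [exact: cauchy_norm_cvg|exists N => // j /= /H].
Qed.

Lemma completion_complete (x : nat -> completion) :
  (forall e : R, 0 < e -> exists N, forall i j, (N <= i)%N -> (N <= j)%N ->
     `|x i - x j| < e) ->
  exists y, `|x i - y| @[i --> \oo] --> (0 : R).
Proof.
move=> cx.
have /choice[u Hu] i : exists a, `|x i - to_completion a| < i.+1%:R^-1.
  have /cvgrPdist_lt/(_ i.+1%:R^-1) := @to_completion_cvg (repr (x i)).
  rewrite invr_gt0 ltr0n cauchy_class_repr => /(_ erefl)[N _ /(_ N (leqnn N))] /= HN.
  by exists (repr (x i) N); rewrite sub0r normrN normr_id distrC in HN.
have cu : u \in cauchy_pred.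
  apply/asboolP => e e0; have e3 : 0 < e / 3 by rewrite divr_gt0.
  have [N HN] := cx _ e3.
  have [M _ HM] : \forall i \near \oo, i.+1%:R^-1 < e / 3 :> R by exact: near_infty_natSinv_lt (PosNum e3).
  exists (maxn N M) => i j; rewrite !geq_max => /andP[Ni Mi] /andP[Nj Mj].
  rewrite -to_completion_norm to_completionB.
  rewrite (_ : _ - _ = (to_completion (u i) - x i) + (x i - x j) + (x j - to_completion (u j))); last first.
    by rewrite !addrA subrK subrK.
  have := ler_normD (to_completion (u i) - x i + (x i - x j)) (x j - to_completion (u j)).
  have := ler_normD (to_completion (u i) - x i) (x i - x j).
  have := HN _ _ Ni Nj; have := Hu i; have := Hu j; have := HM _ Mi; have := HM _ Mj.
  rewrite (distrC (x i) (to_completion _)) /=.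
  by move: (i.+1%:R^-1 : R) (j.+1%:R^-1 : R) => *; lra.
exists (cauchy_class (CauchySeq cu)).
apply: (@squeeze_cvgr _ _ _ _ (fun=> 0)
  (fun i => i.+1%:R^-1 + `|to_completion (u i) - cauchy_class (CauchySeq cu)|)).
- apply: nearW => i; rewrite normr_ge0 /=.
  by rewrite (le_trans (ler_distD (to_completion (u i)) _ _)) // lerD2r ltW.
- exact: cvg_cst.
- rewrite -[X in _ --> X]addr0; apply: cvgD; first exact: cvg_harmonic.
  exact: to_completion_cvg (CauchySeq cu).
Qed.

End Completion.

Notation differential_chain R n k := (completion (dirac_chain R n k)).

Section Integral.
Variables (R : realType) (n k : nat).
Notation chain := (dirac_chain R n k).

Definition bounded_lipschitz (w : {scalar chain}) : Prop :=
  has_ubound [set r | exists p a, mass a = 1 /\ r = `|w (elementary p a)|] /\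
  has_ubound [set r | exists u p a, enorm u * mass a = 1 /\
                                    r = `|w (translate_diff u p a)|].

Definition tends_to (A : nat -> chain) (J : differential_chain R n k) : Prop :=
  `|to_completion (A i) - J| @[i --> \oo] --> (0 : R).

(* Computed along one Cauchy sequence representing J; [chain_integral_cvg]
   below shows that any Dirac chains tending to J give the same limit. *)
Definition chain_integral (J : differential_chain R n k) (w : {scalar chain}) : R :=
  limn (fun i => w (repr J i)).

Lemma enorm0_eq0 (u : 'rV[R]_n) : enorm u = 0 -> u = 0.
Proof.
move=> /eqP; rewrite sqrtr_eq0 mxE => u0; apply/rowP => j; rewrite !mxE.
have : \sum_i u 0 i * u^T i 0 == 0.
  rewrite eq_le u0 /=; apply: sumr_ge0 => i _.
  by rewrite mxE -expr2 sqr_ge0.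
rewrite psumr_eq0 => [/allP/(_ j (mem_index_enum _))|i _].
  by rewrite mxE -expr2 sqrf_eq0 => /eqP.
by rewrite mxE -expr2 sqr_ge0.
Qed.

Lemma translate_diff0 u p : translate_diff u p 0 = 0 :> chain.
Proof. by rewrite /translate_diff (linear0 (elementary p)) (linear0 (elementary _)) subrr. Qed.

Lemma translate_diffZ u p (c : R) a :
  translate_diff u p (c *: a) = c *: translate_diff u p a :> chain.
Proof. by rewrite /translate_diff scalerBr -!linearZ. Qed.

Lemma bounded_lipschitz_le (w : {scalar chain}) : bounded_lipschitz w ->
  exists C : R, forall A, `|w A| <= C * `|A|.
Proof.
move=> [[C1 HC1] [C2 HC2]]; pose C := Num.max 0 (Num.max C1 C2).
have C0 : 0 <= C by rewrite le_max lexx.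
have H1 p a : `|w (elementary p a)| <= C * mass a.
  have [m0|m0] := eqVneq (mass a) 0.
    by rewrite (mass0_eq0 m0) !linear0 normr0 -(mass0_eq0 m0) m0 mulr0.
  have m_gt0 : 0 < mass a by rewrite lt_neqAle eq_sym m0 mass_ge0.
  have : `|w (elementary p ((mass a)^-1 *: a))| <= C1.
    apply: HC1; exists p, ((mass a)^-1 *: a); split=> //.
    by rewrite massZ ger0_norm ?invr_ge0 ?mass_ge0 // mulVf.
  rewrite !linearZ /= normrM ger0_norm ?invr_ge0 ?mass_ge0 // ler_pdivrMl //.
  by move=> /le_trans; apply; rewrite mulrC ler_wpM2r ?mass_ge0 // !le_max lexx !orbT.
have H2 u p a : `|w (translate_diff u p a)| <= C * (enorm u * mass a).
  have [u0|u0] := eqVneq (enorm u) 0.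
    by rewrite u0 (enorm0_eq0 u0) /translate_diff addr0 subrr linear0 normr0 mul0r mulr0.
  have [m0|m0] := eqVneq (mass a) 0.
    by rewrite m0 !mulr0 (mass0_eq0 m0) translate_diff0 linear0 normr0.
  have um0 : 0 < enorm u * mass a.
    by rewrite mulr_gt0 // lt_neqAle eq_sym ?u0 ?m0 ?sqrtr_ge0 ?mass_ge0.
  have : `|w (translate_diff u p ((enorm u * mass a)^-1 *: a))| <= C2.
    apply: HC2; exists u, p, ((enorm u * mass a)^-1 *: a); split=> //.
    by rewrite massZ gtr0_norm ?invr_gt0 // mulrCA mulVf ?lt0r_neq0.
  rewrite translate_diffZ linearZ /= normrM.
  rewrite gtr0_norm ?invr_gt0 // ler_pdivrMl //.
  by move=> /le_trans; apply; rewrite mulrC ler_wpM2r ?(ltW um0) // !le_max lexx !orbT.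
exists C => A; have [C00|C_neq0] := eqVneq C 0.
  have [E ->] := dirac_chainE A.
  rewrite C00 mul0r /B1_chain linearD /= !linear_sum /= !big1 ?addr0 ?normr0 // => x _.
    by have := H2 x.1.1 x.1.2 x.2; rewrite C00 mul0r normr_le0 => /eqP.
  by have := H1 x.1 x.2; rewrite C00 mul0r normr_le0 => /eqP.
have C_gt0 : 0 < C by rewrite lt_neqAle eq_sym C_neq0.
rewrite -ler_pdivrMl //; apply: le_B1_norm => E ->; rewrite ler_pdivrMl //.
rewrite /B1_chain /B1_cost linearD /= !linear_sum /= mulrDr !mulr_sumr.
rewrite (le_trans (ler_normD _ _)) // lerD // (le_trans (ler_norm_sum _ _ _)) //.
  by apply: ler_sum => x _; exact: H1.
by apply: ler_sum => x _; exact: H2.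
Qed.

Lemma chain_integral_cvg (w : {scalar chain}) (A : nat -> chain)
    (J : differential_chain R n k) :
  bounded_lipschitz w -> tends_to A J ->
  w (A i) @[i --> \oo] --> chain_integral J w.
Proof.
move=> /bounded_lipschitz_le[C HC] AJ; pose D := `|C| + 1.
have D0 : 0 < D by rewrite ltr_pwDr.
have HD X : `|w X| <= D * `|X|.
  by rewrite (le_trans (HC _)) // ler_wpM2r // (le_trans (ler_norm _)) // lerDl.
have cJ : cvgn (fun i => w (repr J i)).
  apply: cauchy_cvg; apply/cauchy_ballP => e e0.
  have /asboolP/(_ (e / D)) := valP (repr J).
  rewrite divr_gt0 // => /(_ erefl)[N HN].
  exists ((fun i => w (repr J i)) @` [set i | (N <= i)%N],
          (fun i => w (repr J i)) @` [set i | (N <= i)%N]).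
    by split; exists N => // i /= Ni; exists i.
  move=> [_ _] [[i Ni <-] [j Nj <-]] /=.
  rewrite /ball /= -linearB (le_lt_trans (HD _)) //.
  by rewrite mulrC -ltr_pdivlMr // HN.
rewrite (_ : (fun i => _) = fun i => w (A i - repr J i) + w (repr J i)); last first.
  by apply/funext => i; rewrite linearB /= subrK.
rewrite -[X in _ --> X]add0r; apply: cvgD => //; apply/norm_cvg0P.
apply: (@squeeze_cvgr _ _ _ _ (fun=> 0)
  (fun i => D * (`|to_completion (A i) - J| + `|to_completion (repr J i) - J|))).
- apply: nearW => i; rewrite normr_ge0 (le_trans (HD _)) // ler_wpM2l ?(ltW D0) //.
  rewrite -to_completion_norm to_completionB.
  by rewrite (le_trans (ler_distD J _ _)) // (distrC J).
- exact: cvg_cst.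
- rewrite -[X in _ --> X](mulr0 D); apply: cvgMl_tmp; rewrite -[X in _ --> X]addr0.
  apply: cvgD => //.
  have := @to_completion_cvg _ _ (repr J); rewrite cauchy_class_repr; exact.
Qed.

End Integral.

Section Riemann.
Variables (R : realType) (n : nat).
Implicit Types (f : 'rV[R]_n -> R) (a b : 'rV[R]_n).

(* [P i 0 <= ... <= P i m] subdivides the i-th side. Repeated points are allowed
   (degenerate cells contribute 0), so a single m for all sides is no loss. *)
Definition grid_partition a b (m : nat) (P : 'I_n -> nat -> R) : Prop :=
  forall i, [/\ P i 0%N = a 0 i, P i m = b 0 i &
                forall j, (j < m)%N -> P i j <= P i j.+1].

Definition tags_in_cells m (P : 'I_n -> nat -> R)
    (t : {ffun 'I_n -> 'I_m} -> 'rV[R]_n) : Prop :=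
  forall (c : {ffun 'I_n -> 'I_m}) i, P i (c i) <= t c 0 i <= P i (c i).+1.

Definition riemann_sum f m (P : 'I_n -> nat -> R)
    (t : {ffun 'I_n -> 'I_m} -> 'rV[R]_n) : R :=
  \sum_(c : {ffun 'I_n -> 'I_m}) f (t c) * \prod_i (P i (c i).+1 - P i (c i)).

Definition has_riemann_integral f a b (v : R) : Prop :=
  forall e : R, 0 < e -> exists2 d : R, 0 < d &
    forall m (P : 'I_n -> nat -> R) (t : {ffun 'I_n -> 'I_m} -> 'rV[R]_n),
      grid_partition a b m P -> tags_in_cells P t ->
      (forall i j, (j < m)%N -> P i j.+1 - P i j < d) ->
      `|riemann_sum f P t - v| < e.

(* A pair (a, s) encodes the cube prod_i [a_i, a_i + s]. *)
Notation cube := ('rV[R]_n * R)%type.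

Definition closed_cube (Q : cube) : set 'rV[R]_n :=
  [set x | forall i, Q.1 0 i <= x 0 i <= Q.1 0 i + Q.2].

Definition open_cube (Q : cube) : set 'rV[R]_n :=
  [set x | forall i, Q.1 0 i < x 0 i < Q.1 0 i + Q.2].

Definition cube_diam (Q : cube) : R := Num.sqrt n%:R * Q.2.

(* In dimension 0 with U = R^0 the complement is empty and the infimum is 0, so
   the size condition below still makes sense. *)
Definition dist_compl (U : set 'rV[R]_n) (Q : cube) : R :=
  inf [set enorm (x - y) | x in closed_cube Q & y in ~` U].

Definition whitney_decomposition (U : set 'rV[R]_n) (D : set cube) : Prop :=
  [/\ forall Q, D Q -> 0 < Q.2,
      \bigcup_(Q in D) closed_cube Q = U,
      forall Q Q', D Q -> D Q' -> Q <> Q' -> open_cube Q `&` open_cube Q' = set0 &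
      forall Q, D Q -> cube_diam Q <= dist_compl U Q <= 4 * cube_diam Q].

(* Unconditional sum: limit over the finite subsets of D. *)
Definition has_sum (T : choiceType) (D : set T) (g : T -> R) (v : R) : Prop :=
  forall e : R, 0 < e -> exists F0 : set T,
    [/\ finite_set F0, F0 `<=` D &
        forall F, finite_set F -> F0 `<=` F -> F `<=` D ->
          `|\sum_(x \in F) g x - v| < e].

(* v is the sum of the Riemann integrals over the cubes of a Whitney
   decomposition of U, whichever decomposition is taken. *)
Definition has_riemann_integral_open (U : set 'rV[R]_n) f (v : R) : Prop :=
  (exists D, whitney_decomposition U D) /\
  forall D, whitney_decomposition U D ->
    exists2 I : cube -> R,
      forall Q, D Q -> has_riemann_integral f Q.1 (Q.1 + const_mx Q.2) (I Q) &
      has_sum D I v.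

(* The function f with w = f dx_1 /\ ... /\ dx_n: its value at p is
   w (p; e_1 /\ ... /\ e_n). *)
Definition top_coeff (w : {scalar dirac_chain R n n}) (p : 'rV[R]_n) : R :=
  w (elementary p (wedge_rows 1%:M)).

End Riemann.

(* Main.v *)
From HB Require Import structures.
Require Import Defs.
From mathcomp Require Import all_boot all_order all_algebra.
From mathcomp Require Import all_classical all_reals all_analysis.
From mathcomp Require Import ring lra.
Import numFieldNormedType.Exports.
Set Implicit Arguments.
Unset Strict Implicit.
Unset Printing Implicit Defensive.
Import Order.TTheory GRing.Theory Num.Theory.
Local Open Scope classical_set_scope.
Local Open Scope ring_scope.

(** Why the theorem holds.

    Put [U] in a box [[-M, M]^n] and let [A_k] be the Dirac chain made of one point
    mass [h_k^n e_1 /\ ... /\ e_n] at the lower corner of each closed dyadic cell of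
    level [k] (side [h_k = 2M / 2^k]) contained in [U]. Passing to level [k + 1]
    moves the mass of each old cell to the corners of its children, at a cost of at
    most one diameter times its volume, and adds the cells that have become inner
    ones, at a cost equal to the volume gained. The diameters are summable and the
    inner volume is increasing and bounded, so [(A_k)] is Cauchy for the B^1 norm
    ([inner_chain_cauchy]). Its limit is the chain sought ([inner_limit]); the
    construction makes sense for any set, in particular for the cubes of a
    Whitney decomposition.

    Two facts identify the integral over that limit.
    - Over a cube it is the Riemann integral ([riemann_integral_cube]). The number of
      nodes of a fine grid in a box, times the cell volume, tends to the volume of
      the box; so the grid sums can be compared with any tagged partition, the
      coefficient of the form being Lipschitz.
    - It is additive over non-overlapping cubes filling [U] ([has_sum_cubes]). The
      inner cells of finitely many such cubes are distinct inner cells of [U], and the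
      form is bounded, so the error is controlled by the inner volume of [U] minus the
      volume of these cubes. Finitely many cubes capture almost all the inner volume:
      the inner cells of one level have a compact union, covered by finitely many
      slightly enlarged cubes ([finite_subcover_volume]).
    Both hold for any family of non-overlapping cubes with union [U], so all Whitney
    decompositions give the same sum; there is one, made of maximal dyadic cubes
    ([maximal_far_cubes_whitney]).

    For uniqueness, two chains with this property have the same integrals, since
    Riemann integrals and unconditional sums are unique. Bounded Lipschitz forms
    are exactly the functionals bounded for the B^1 norm, so by Hahn-Banach they
    separate the points of the completion ([chain_separation]). Hahn-Banach is
    proved in the form: minimal sublinear functionals are linear. *)

(** * Sequential limits *)

Lemma cvgn_dist (R : realType) (u : nat -> R) (l : R) :
  u i @[i --> \oo] --> l <->
  forall e : R, 0 < e -> exists N, forall i, (N <= i)%N -> `|u i - l| < e.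
Proof.
split=> [/cvgrPdist_lt ul e /ul[N _ HN]|H].
  by exists N => i /HN /=; rewrite distrC.
apply/cvgrPdist_lt => e /H[N HN]; exists N => // i /= /HN.
by rewrite distrC.
Qed.

Lemma cvgn_exp (R : realType) (u : nat -> R) (l : R) m :
  u i @[i --> \oo] --> l -> u i ^+ m @[i --> \oo] --> l ^+ m.
Proof.
move=> ul; elim: m => [|m IH].
  by under eq_fun do rewrite expr0; exact: cvg_cst.
by rewrite exprS; under eq_fun do rewrite exprS; exact: cvgM.
Qed.

(** * Separation of chains by bounded functionals *)

Section HahnBanach.
Variables (R : realType) (V : lmodType R).
Implicit Types (p q : V -> R) (x y : V).

Definition sublinear q : Prop :=
  (forall x y, q (x + y) <= q x + q y) /\
  (forall (t : R) x, 0 <= t -> q (t *: x) = t * q x).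

Lemma sublinear0 q : sublinear q -> q 0 = 0.
Proof. by move=> [_ qZ]; rewrite -[X in q X](scale0r 0) qZ // mul0r. Qed.

Lemma sublinear_geN q x : sublinear q -> - q (- x) <= q x.
Proof.
move=> sq; have := sq.1 x (- x); rewrite subrr sublinear0 //; lra.
Qed.

(** Lowering [q] as far as possible along [x]: the result is still sublinear and
    takes a value at most [- q x] at [- x], which is what a linear functional
    below [q] and equal to [q] at [x] would do. *)
Definition lower q x y : R :=
  inf [set q (y + t *: x) - t * q x | t in [set t : R | 0 <= t]].

Lemma lower_has_inf q x y : sublinear q ->
  has_inf [set q (y + t *: x) - t * q x | t in [set t : R | 0 <= t]].
Proof.
move=> sq; split; first by exists (q (y + 0 *: x) - 0 * q x); exists 0 => /=.
exists (- q (- y)) => _ [t /= t0 <-].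
have := sq.1 (y + t *: x) (- y); rewrite addrAC subrr add0r sq.2 //; lra.
Qed.

Lemma lower_le q x y (t : R) : sublinear q -> 0 <= t ->
  lower q x y <= q (y + t *: x) - t * q x.
Proof.
by move=> sq t0; apply: ge_inf; [exact: (lower_has_inf x y sq).2|exists t].
Qed.

Lemma le_lower q x y (a : R) : sublinear q ->
  (forall t : R, 0 <= t -> a <= q (y + t *: x) - t * q x) -> a <= lower q x y.
Proof.
move=> sq H; apply: lb_le_inf; first exact: (lower_has_inf x y sq).1.
by move=> _ [t /= t0 <-]; exact: H.
Qed.

Lemma lower_le_self q x y : sublinear q -> lower q x y <= q y.
Proof.
by move=> sq; apply: le_trans (lower_le x y sq (lexx 0)) _; rewrite scale0r addr0 mul0r subr0.
Qed.

Lemma lower_opp q x : sublinear q -> lower q x (- x) <= - q x.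
Proof.
move=> sq; apply: le_trans (lower_le x (- x) sq ler01) _.
by rewrite scale1r addNr (sublinear0 sq) mul1r sub0r.
Qed.

Lemma lower_sublinear q x : sublinear q -> sublinear (lower q x).
Proof.
move=> sq; split=> [y z|t y t0].
  rewrite -lerBlDr; apply: (le_lower sq) => t t0.
  rewrite lerBlDl -lerBlDr; apply: (le_lower sq) => s s0.
  rewrite lerBlDr; apply: le_trans (lower_le x (y + z) sq (addr_ge0 s0 t0)) _.
  have := sq.1 (y + t *: x) (z + s *: x).
  rewrite addrACA -scalerDl (addrC t s); lra.
have [->|tn0] := eqVneq t 0.
  rewrite scale0r mul0r; apply/eqP; rewrite eq_le.
  have := lower_le_self x 0 sq; rewrite (sublinear0 sq) => -> /=.
  apply: (le_lower sq) => s s0; rewrite add0r sq.2 //; lra.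
have tgt0 : 0 < t by rewrite lt_neqAle eq_sym tn0.
apply/eqP; rewrite eq_le; apply/andP; split.
  rewrite -ler_pdivrMl //; apply: (le_lower sq) => s s0; rewrite ler_pdivrMl //.
  apply: le_trans (lower_le x (t *: y) sq (mulr_ge0 t0 s0)) _.
  by rewrite -scalerA -scalerDr sq.2 // mulrBr mulrA.
apply: (le_lower sq) => s s0.
have u0 : 0 <= s / t by rewrite divr_ge0.
rewrite -ler_pdivlMl //; apply: le_trans (lower_le x y sq u0) _.
rewrite ler_pdivlMl // mulrBr -(sq.2 t) // scalerDr scalerA (mulrA t (s / t)).
by rewrite (_ : t * (s / t) = s) // mulrC divfK.
Qed.

(** Zorn applies because a chain of sublinear functionals has its pointwise
    infimum as a sublinear lower bound, finite since all members dominate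
    [x |-> - p (- x)]. *)
Lemma minimal_sublinear p : sublinear p -> exists q,
  [/\ sublinear q, (forall x, q x <= p x) &
      forall r, sublinear r -> (forall x, r x <= q x) -> r = q].
Proof.
move=> sp; pose T := {q : V -> R | sublinear q /\ forall x, q x <= p x}.
pose le_T (a b : T) := `[< forall x, sval b x <= sval a x >].
have [||||m Hm] := @Zorn T le_T.
- by move=> a; apply/asboolP.
- by move=> a b c /asboolP ab /asboolP bc; apply/asboolP => x; exact: le_trans (ab x).
- move=> [a Ha] [b Hb] /asboolP/= ab /asboolP/= ba; apply: eq_exist.
  by apply/funext => x; apply/eqP; rewrite eq_le ab ba.
- move=> A totA; have [[a0 Aa0]|A0] := pselect (A !=set0); last first.
    exists (exist _ p (conj sp (fun x => lexx (p x)))) => s As.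
    by exfalso; apply: A0; exists s.
  pose S x := [set sval a x | a in A]; pose q x := inf (S x).
  have S_inf x : has_inf (S x).
    split; first by exists (sval a0 x); exists a0.
    exists (- p (- x)) => _ [a _ <-]; have [sa ap] := svalP a.
    by apply: le_trans (sublinear_geN x sa); rewrite lerN2.
  have q_le a x : A a -> q x <= sval a x.
    by move=> Aa; apply: ge_inf; [exact: (S_inf x).2|exists a].
  have inf_ge x (c : R) : (forall a, A a -> c <= sval a x) -> c <= q x.
    move=> H; apply: lb_le_inf; first exact: (S_inf x).1.
    by move=> _ [a Aa <-]; exact: H.
  have sq : sublinear q.
    split=> [x y|t x t0].
      rewrite -lerBlDr; apply: (inf_ge _) => a Aa; rewrite lerBlDl -lerBlDr.
      apply: (inf_ge _) => b Ab; rewrite lerBlDr.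
      have [/asboolP ab|/asboolP ba] := totA a b Aa Ab.
        apply: le_trans (q_le b _ Ab) _; apply: le_trans ((svalP b).1.1 _ _) _.
        by rewrite addrC lerD2l.
      apply: le_trans (q_le a _ Aa) _; apply: le_trans ((svalP a).1.1 _ _) _.
      by rewrite [leLHS]addrC lerD2r.
    have [->|tn0] := eqVneq t 0.
      rewrite scale0r mul0r; apply/eqP; rewrite eq_le; apply/andP; split.
        by apply: le_trans (q_le a0 _ Aa0) _; rewrite sublinear0 //; exact: (svalP a0).1.
      by apply: (inf_ge _) => a Aa; rewrite sublinear0 //; exact: (svalP a).1.
    have tgt0 : 0 < t by rewrite lt_neqAle eq_sym tn0.
    apply/eqP; rewrite eq_le; apply/andP; split.
      rewrite -ler_pdivrMl //; apply: (inf_ge _) => a Aa; rewrite ler_pdivrMl //.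
      by rewrite -(svalP a).1.2 //; exact: q_le.
    by apply: (inf_ge _) => a Aa; rewrite (svalP a).1.2 // ler_pM2l // q_le.
  have qp x : q x <= p x by apply: le_trans (q_le a0 x Aa0) ((svalP a0).2 x).
  by exists (exist _ q (conj sq qp)) => a Aa; apply/asboolP => x; exact: q_le.
exists (sval m); split; [exact: (svalP m).1|exact: (svalP m).2|] => r sr rm.
have rp x : r x <= p x by apply: le_trans (rm x) ((svalP m).2 x).
by have <- := Hm (exist _ r (conj sr rp)) (asboolT rm).
Qed.

(** Minimality forces [lower q x = q], so [q (- x) <= - q x]; with
    subadditivity this makes [q] odd, hence linear. Starting the minimization
    from [lower p x0] instead of [p] fixes the value at [x0]. *)
Lemma hahn_banach p (x0 : V) : sublinear p ->
  exists f : {scalar V}, (forall x, f x <= p x) /\ p x0 <= f x0.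
Proof.
move=> sp; have [q [sq qp qmin]] := minimal_sublinear (lower_sublinear x0 sp).
have qN x : q (- x) = - q x.
  have := lower_opp x sq.
  rewrite (qmin (lower q x)) => [|//|]; last 2 first.
  - exact: lower_sublinear.
  - by move=> y; exact: lower_le_self.
  by have := sublinear_geN x sq; move=> *; apply/eqP; rewrite eq_le; apply/andP; split; lra.
have qD x y : q (x + y) = q x + q y.
  apply/eqP; rewrite eq_le sq.1 /=.
  by have := sq.1 (x + y) (- y); rewrite addrK qN; lra.
have qlin : scalar q.
  move=> t x y; rewrite qD; congr (_ + _).
  have [t0|t0] := leP 0 t; first by rewrite sq.2.
  by rewrite -[t in t *: x]opprK scaleNr qN sq.2 ?oppr_ge0 ?(ltW t0) //= mulNr opprK.
pose f : {scalar V} := HB.pack q (GRing.isLinear.Build _ _ _ _ q qlin).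
exists f; split=> [x|]; first by apply: le_trans (qp x) (lower_le_self x0 x sp).
have := le_trans (qp (- x0)) (lower_opp x0 sp); rewrite qN /f /=; lra.
Qed.

End HahnBanach.

Section Separation.
Variables (R : realType) (n k : nat).
Notation chain := (dirac_chain R n k).

Lemma B1_normrE (A : chain) : `|A| = B1_norm A.
Proof. by []. Qed.

Lemma elementary_norm_le p (a : kvector R n k) : `|elementary p a| <= mass a.
Proof.
have := B1_norm_le ([:: (p, a)], [::] : seq ('rV[R]_n * 'rV[R]_n * kvector R n k)).
by rewrite /B1_chain /B1_cost /= !big_seq1 !big_nil !addr0.
Qed.

Lemma translate_diff_norm_le u p (a : kvector R n k) :
  `|translate_diff u p a| <= enorm u * mass a.
Proof.
have := B1_norm_le ([::] : seq ('rV[R]_n * kvector R n k), [:: (u, p, a)]).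
by rewrite /B1_chain /B1_cost /= !big_seq1 !big_nil !add0r.
Qed.

Lemma dominated_bounded_lipschitz (w : {scalar chain}) :
  (forall A, `|w A| <= `|A|) -> bounded_lipschitz w.
Proof.
move=> wle; split; exists 1.
  move=> _ [p [a [a1 ->]]]; rewrite -a1; exact: le_trans (wle _) (elementary_norm_le _ _).
move=> _ [u [p [a [ua1 ->]]]]; rewrite -ua1; exact: le_trans (wle _) (translate_diff_norm_le _ _ _).
Qed.

Lemma repr_tends_to (J : differential_chain R n k) : tends_to (repr J) J.
Proof. by have := to_completion_cvg (repr J); rewrite cauchy_class_repr. Qed.

(** A form tells distinct [J] and [J'] apart: along Cauchy sequences for them the
    difference [B i] keeps norm near [|J - J'|], and a functional norming one [B i]
    far enough out cannot vanish in the limit. *)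
Lemma chain_separation (J J' : differential_chain R n k) :
  (forall w : {scalar chain}, bounded_lipschitz w ->
     chain_integral J w = chain_integral J' w) -> J = J'.
Proof.
move=> eqJ; apply/eqP; rewrite -subr_eq0 -normr_le0 leNgt; apply/negP => c0.
set c := `|J - J'| in c0.
(* Both sequences are within [c / 8] of their limits past [i0], so [|B i0|] is at
   least [3c / 4] and [|B i - B i0|] at most [c / 2], leaving [c / 4]. *)
have c8 : 0 < c / 8 by rewrite divr_gt0.
have [N HN] := (cvgn_dist _ _).1 (repr_tends_to J) _ c8.
have [N' HN'] := (cvgn_dist _ _).1 (repr_tends_to J') _ c8.
pose B i : chain := repr J i - repr J' i; pose i0 := maxn N N'.
have near_c i : (i0 <= i)%N -> `|to_completion (B i) - (J - J')| < c / 4.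
  rewrite /i0 geq_max => /andP[/HN/= Ni /HN'/= N'i].
  rewrite subr0 normr_id in Ni; rewrite subr0 normr_id in N'i.
  rewrite /B to_completionB.
  set X := to_completion _ in Ni *; set Y := to_completion _ in N'i *.
  have -> : X - Y - (J - J') = (X - J) - (Y - J').
    by rewrite !opprB addrACA [in RHS]addrACA (addrC (- Y)).
  by apply: le_lt_trans (ler_normB _ _) _; lra.
have sn : sublinear (fun A : chain => `|A|).
  split=> [A A'|t A t0]; first exact: ler_normD.
  by rewrite !B1_normrE B1_normZ ger0_norm.
have [f [f_le f_ge]] := hahn_banach (B i0) sn.
have f_abs A : `|f A| <= `|A|.
  by rewrite ler_norml f_le andbT lerNl -linearN /= (le_trans (f_le _)) // normrN.
have bf := dominated_bounded_lipschitz f_abs.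
have fB : f (B i) @[i --> \oo] --> (0 : R).
  rewrite (_ : (fun i => _) = fun i => f (repr J i) - f (repr J' i)); last first.
    by apply/funext => i; rewrite linearB.
  rewrite -(subrr (chain_integral J f)) {2}(eqJ _ bf).
  by apply: cvgB; apply: chain_integral_cvg => //; exact: repr_tends_to.
have fB_lb i : (i0 <= i)%N -> c / 4 <= f (B i).
  move=> i0i; have := near_c i i0i; have := near_c i0 (leqnn _).
  have := f_abs (B i0 - B i); rewrite linearB /= => /(le_trans (ler_norm _)).
  rewrite -(to_completion_norm (B i0 - B i)) to_completionB.
  have := ler_distD (J - J') (to_completion (B i0)) (to_completion (B i)).
  rewrite (distrC (J - J')).
  have := ler_distD (to_completion (B i0)) (J - J') 0.
  rewrite !subr0 (distrC (J - J') (to_completion (B i0))) -/c to_completion_norm.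
  lra.
have [M HM] := (cvgn_dist _ _).1 fB (c / 4) (divr_gt0 c0 (ltr0n _ 4)).
have := HM (maxn i0 M) (leq_maxr _ _); rewrite subr0 => /(le_lt_trans (ler_norm _)).
by rewrite ltNge fB_lb // leq_maxl.
Qed.

End Separation.

(** * Euclidean norm and unit n-vector *)

Section EuclideanNorm.
Variables (R : realType) (n : nat).
Implicit Types u v : 'rV[R]_n.

Lemma enormE u : enorm u = Num.sqrt (\sum_i u 0 i ^+ 2).
Proof.
by rewrite /enorm mxE; congr Num.sqrt; apply: eq_bigr => i _; rewrite mxE expr2.
Qed.

Lemma enorm_ge0 u : 0 <= enorm u.
Proof. exact: sqrtr_ge0. Qed.

(** Vectors are the 1-vectors, so the triangle inequality is the one already
    known for the Euclidean mass of k-vectors. *)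
Lemma enormD u v : enorm (u + v) <= enorm u + enorm v.
Proof.
have wE (x : 'rV[R]_n) : enorm x = simple_mass (wedge_rows x).
  by rewrite /simple_mass kinner_wedge_rows det_mx11.
rewrite !wE (_ : wedge_rows (u + v) = wedge_rows u + wedge_rows v).
  exact: simple_massD.
by apply/ffunP => I; rewrite !ffunE !det_mx11 !mxE.
Qed.

Lemma enormN u : enorm (- u) = enorm u.
Proof. by rewrite !enormE; congr Num.sqrt; apply: eq_bigr => i _; rewrite mxE sqrrN. Qed.

Lemma enorm_distD w u v : enorm (u - v) <= enorm (u - w) + enorm (w - v).
Proof. by apply: le_trans (enormD _ _); rewrite addrA subrK. Qed.

Lemma enorm0 : enorm (0 : 'rV[R]_n) = 0.
Proof. by rewrite enormE big1 ?sqrtr0 // => i _; rewrite mxE expr0n. Qed.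

Lemma enorm_le u (d : R) : 0 <= d -> (forall i, `|u 0 i| <= d) ->
  enorm u <= Num.sqrt n%:R * d.
Proof.
move=> d0 ud; rewrite enormE -[d in leRHS](ger0_norm d0) -sqrtr_sqr -sqrtrM ?ler0n //.
rewrite ler_wsqrtr // -[n in n%:R]card_ord mulr_natl -sumr_const.
by apply: ler_sum => i _; rewrite -real_normK ?num_real // lerXn2r ?nnegrE.
Qed.

Lemma coord_le_enorm u i : `|u 0 i| <= enorm u.
Proof.
rewrite enormE -sqrtr_sqr ler_wsqrtr // (bigD1 i) //= lerDl.
by apply: sumr_ge0 => j _; exact: sqr_ge0.
Qed.

(** The norm [`|u|] of a row vector is the sup norm. *)
Lemma coord_le_norm (u : 'rV[R]_n) i : `|u 0 i| <= `|u|.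
Proof.
by rewrite [leRHS]/Num.norm /= mx_normrE; apply/bigmax_geP; right => /=; exists (0, i).
Qed.

Lemma norm_lt (u : 'rV[R]_n) (d : R) : 0 < d -> (forall i, `|u 0 i| < d) -> `|u| < d.
Proof.
move=> d0 ud; rewrite [ltLHS]/Num.norm /= mx_normrE; apply/bigmax_ltP; split=> // -[i j] _.
by rewrite /= ord1.
Qed.

Lemma norm_le_enorm u : `|u| <= enorm u.
Proof.
rewrite [leLHS]/Num.norm /= mx_normrE; apply/bigmax_leP; split; first exact: enorm_ge0.
by move=> [i j] _ /=; rewrite ord1; exact: coord_le_enorm.
Qed.

Definition unit_nvector : kvector R n n := wedge_rows 1%:M.

Lemma mass_unit_nvector : mass unit_nvector = 1.
Proof.
rewrite mass_simple; last by exists 1, 1%:M; rewrite scale1r.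
by rewrite /simple_mass kinner_wedge_rows trmx1 mulmx1 det1 sqrtr1.
Qed.

Lemma top_coeff_bounded (w : {scalar dirac_chain R n n}) : bounded_lipschitz w ->
  exists2 C : R, 0 <= C & forall p, `|top_coeff w p| <= C /\
    forall q, `|top_coeff w p - top_coeff w q| <= C * enorm (p - q).
Proof.
move=> /bounded_lipschitz_le[C HC]; exists `|C| => // p.
have HC' A : `|w A| <= `|C| * `|A|.
  by apply: le_trans (HC A) _; rewrite ler_wpM2r // ler_norm.
split=> [|q].
  apply: le_trans (HC' _) _; rewrite -[leRHS]mulr1 ler_wpM2l //.
  by have := elementary_norm_le p unit_nvector; rewrite mass_unit_nvector.
rewrite /top_coeff -linearB /=; apply: le_trans (HC' _) _; rewrite ler_wpM2l //.
have := translate_diff_norm_le (p - q) q unit_nvector.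
by rewrite mass_unit_nvector mulr1 /translate_diff (addrC q) subrK.
Qed.

End EuclideanNorm.

(** * Inner dyadic approximations *)

Section Grid.
Variables (R : realType) (n : nat) (M : R).
Hypothesis M0 : 0 < M.
Implicit Types X Y : set 'rV[R]_n.

Definition mesh (k : nat) : R := 2 * M / 2 ^+ k.

Definition node k (j : nat) : R := - M + mesh k * j%:R.

Definition cell_index k := {ffun 'I_n -> 'I_(2 ^ k)}.

Definition corner k (z : cell_index k) : 'rV[R]_n := \row_i node k (z i).

Definition cell k (z : cell_index k) : 'rV[R]_n * R := (corner z, mesh k).

Definition cell_in X k (z : cell_index k) : bool := `[< closed_cube (cell z) `<=` X >].

Definition inner_chain X k : dirac_chain R n n :=
  \sum_(z : cell_index k | cell_in X z) mesh k ^+ n *: elementary (corner z) (unit_nvector R n).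

Definition inner_volume X k : R := \sum_(z : cell_index k | cell_in X z) mesh k ^+ n.

Lemma mesh_gt0 k : 0 < mesh k.
Proof. by rewrite /mesh divr_gt0 ?mulr_gt0 ?exprn_gt0 ?ltr0n. Qed.

Lemma mesh_ge0 k : 0 <= mesh k.
Proof. exact/ltW/mesh_gt0. Qed.

Lemma mesh0 : mesh 0 = 2 * M.
Proof. by rewrite /mesh expr0 divr1. Qed.

Lemma meshS k : mesh k = 2 * mesh k.+1.
Proof. by rewrite /mesh exprS invfM mulrCA (mulrA 2 2^-1) divff ?mul1r. Qed.

Lemma mesh_pow k d : mesh k = 2 ^+ d * mesh (d + k)%N.
Proof. by elim: d => [|d IH]; rewrite ?expr0 ?mul1r // IH addSn meshS exprSr mulrA. Qed.

Lemma mesh_small (e : R) : 0 < e -> exists N, forall k, (N <= k)%N -> mesh k < e.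
Proof.
move=> e0; have /cvgn_dist/(_ _ e0)[N HN] : mesh k @[k --> \oo] --> (0 : R).
  rewrite -(mulr0 (2 * M)) /mesh; apply: cvgMl_tmp.
  rewrite (_ : (fun k => _) = fun k => (2^-1 : R) ^+ k); last first.
    by apply/funext => k; rewrite exprVn.
  by apply: cvg_expr; rewrite ger0_norm ?invr_ge0 // invf_lt1 ?ltr1n.
by exists N => k /HN; rewrite subr0 gtr0_norm ?mesh_gt0.
Qed.

Lemma total_cells_volume k : \sum_(z : cell_index k) mesh k ^+ n = (2 * M) ^+ n.
Proof.
rewrite sumr_const card_ffun !card_ord -[LHS]mulr_natl natrX natrX -exprMn.
by rewrite /mesh mulrC divfK // lt0r_neq0 // exprn_gt0.
Qed.

Lemma half_bound k (j : 'I_(2 ^ k.+1)) : (j./2 < 2 ^ k)%N.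
Proof. by rewrite ltn_half_double -mul2n -expnS. Qed.

Definition parent k (z : cell_index k.+1) : cell_index k :=
  [ffun i => Ordinal (half_bound (z i))].

Lemma card_children k (z : cell_index k) :
  #|[pred c : cell_index k.+1 | parent c == z]| = (2 ^ n)%N.
Proof.
have lo i : ((z i).*2 < 2 ^ k.+1)%N by rewrite expnS mul2n ltn_double.
have hi i : ((z i).*2.+1 < 2 ^ k.+1)%N by rewrite expnS mul2n ltn_Sdouble.
pose F i : {pred 'I_(2 ^ k.+1)} := [pred j | (j == Ordinal (lo i)) || (j == Ordinal (hi i))].
rewrite (_ : #|_| = #|family F|); last first.
  apply: eq_card => c; rewrite !inE; apply/eqP/forallP => [E i|cF].
    have zi : z i = (c i)./2 :> nat by rewrite -E ffunE.
    rewrite !inE -!val_eqE /= zi -{1 3}(odd_double_half (c i)).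
    by case: odd; rewrite ?eqxx ?orbT.
  apply/ffunP => i; rewrite ffunE; apply/val_inj => /=.
  have := cF i; rewrite !inE -!val_eqE /= => /orP[/eqP->|/eqP->].
    by rewrite doubleK.
  by rewrite -[_.+1]/(true + _)%N half_bit_double.
rewrite card_family (_ : [seq _ | x : _] = nseq n 2%N).
  by elim: n => //= m ->; rewrite expnS.
apply: (@eq_from_nth _ 0%N); first by rewrite size_map size_nseq -cardE card_ord.
move=> i; rewrite size_map -cardE card_ord => ni; rewrite nth_nseq ni.
rewrite (nth_map (Ordinal ni)) -?cardE ?card_ord // /F card2 -val_eqE /=.
by rewrite neq_ltn ltnSn.
Qed.

(** The volume of a cell is shared among its [2 ^ n] children; this carries sums
    over one level to the next, where they can be compared. *)
Lemma sum_children (V : lmodType R) k (P : pred (cell_index k)) (F : cell_index k -> V) :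
  \sum_(z | P z) mesh k ^+ n *: F z =
  \sum_(c | P (parent c)) mesh k.+1 ^+ n *: F (parent c).
Proof.
rewrite (partition_big (@parent k) P) //=; apply: eq_bigr => z Pz.
rewrite (eq_bigl [pred c | parent c == z]) => [|c]; last first.
  by rewrite /=; case: eqP => [->|_]; rewrite ?Pz ?andbF.
rewrite (eq_bigr (fun=> mesh k.+1 ^+ n *: F z)) => [|c /eqP -> //].
rewrite sumr_const card_children -scaler_nat scalerA natrX -exprMn.
by rewrite -meshS.
Qed.

Lemma node_half k (j : nat) : node k j./2 <= node k.+1 j /\
  node k.+1 j + mesh k.+1 <= node k j./2 + mesh k.
Proof.
have E : j%:R = (odd j)%:R + 2 * (j./2)%:R :> R.
  by rewrite -natrM -natrD mul2n odd_double_half.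
have m0 := mesh_gt0 k.+1; rewrite /node [mesh k]meshS E.
move: (j./2)%:R => x; case: (odd j) => /=; split; nra.
Qed.

Lemma cell_parent k (c : cell_index k.+1) :
  closed_cube (cell c) `<=` closed_cube (cell (parent c)).
Proof.
move=> x xc i; have := xc i; rewrite /= !mxE ffunE /=.
by have [] := node_half k (c i); move=> *; apply/andP; split; lra.
Qed.

Lemma corner_in k (z : cell_index k) : closed_cube (cell z) (corner z).
Proof. by move=> i; rewrite /= lexx lerDl mesh_ge0. Qed.

Lemma corner_parent k (c : cell_index k.+1) :
  enorm (corner c - corner (parent c)) <= Num.sqrt n%:R * mesh k.
Proof.
apply: enorm_le; first exact: mesh_ge0.
move=> i; rewrite !mxE ffunE /=; have [] := node_half k (c i).
have := mesh_ge0 k.+1 => *; rewrite ger0_norm; lra.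
Qed.

Lemma cell_in_sub X Y k (z : cell_index k) : X `<=` Y -> cell_in X z -> cell_in Y z.
Proof. by move=> XY /asboolP zX; apply/asboolP; exact: subset_trans XY. Qed.

Lemma cell_in_child X k (c : cell_index k.+1) : cell_in X (parent c) -> cell_in X c.
Proof. by move=> /asboolP pX; apply/asboolP => x /cell_parent; exact: pX. Qed.

Lemma sum_new_cells (V : nmodType) X k (F : cell_index k.+1 -> V) :
  \sum_(c | cell_in X c) F c = \sum_(c | cell_in X (parent c)) F c +
    \sum_(c | cell_in X c && ~~ cell_in X (parent c)) F c.
Proof.
rewrite (bigID (fun c => cell_in X (parent c))) /=; congr (_ + _).
by apply: eq_bigl => c; rewrite andb_idl //; exact: cell_in_child.
Qed.

Lemma inner_volumeS X k :
  inner_volume X k = \sum_(c : cell_index k.+1 | cell_in X (parent c)) mesh k.+1 ^+ n.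
Proof.
have := sum_children (@cell_in X k) (fun=> 1 : R^o).
under eq_bigr do rewrite /GRing.scale /= mulr1.
by under [RHS]eq_bigr do rewrite /GRing.scale /= mulr1.
Qed.

Lemma inner_volume_incr X k : inner_volume X k <= inner_volume X k.+1.
Proof.
rewrite (inner_volumeS X k) [leRHS]sum_new_cells lerDl.
by rewrite sumr_ge0 // => c _; rewrite exprn_ge0 ?mesh_ge0.
Qed.

Lemma inner_volume_le_total X k : inner_volume X k <= (2 * M) ^+ n.
Proof.
rewrite -(total_cells_volume k) /inner_volume [leRHS](bigID (fun z => cell_in X z)) /=.
by rewrite lerDl sumr_ge0 // => c _; rewrite exprn_ge0 ?mesh_ge0.
Qed.

(** Replacing a cell by its children moves mass by at most one diameter; the
    children of new cells carry exactly the newly gained volume. *)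
Lemma inner_chain_step X k : `|inner_chain X k.+1 - inner_chain X k| <=
  Num.sqrt n%:R * mesh k * (2 * M) ^+ n + (inner_volume X k.+1 - inner_volume X k).
Proof.
rewrite /inner_chain (sum_children (@cell_in X k) (fun z => elementary (corner z) (unit_nvector R n))).
rewrite sum_new_cells addrAC -sumrB.
rewrite (inner_volumeS X k) [inner_volume X k.+1]sum_new_cells [in leRHS](addrC (\sum_(c | _) _)) addrK.
apply: le_trans (ler_normD _ _) _; apply: lerD.
  apply: le_trans (ler_norm_sum _ _ _) _.
  apply: (@le_trans _ _ (\sum_(c : cell_index k.+1 | cell_in X (parent c))
      mesh k.+1 ^+ n * (Num.sqrt n%:R * mesh k))).
    apply: ler_sum => c _; rewrite -scalerBr B1_normrE B1_normZ.
    rewrite ger0_norm ?exprn_ge0 ?mesh_ge0 //; apply: ler_wpM2l; first by rewrite exprn_ge0 ?mesh_ge0.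
    have := translate_diff_norm_le (corner c - corner (parent c)) (corner (parent c)) (unit_nvector R n).
    rewrite mass_unit_nvector mulr1 /translate_diff (addrC (corner (parent c))) subrK B1_normrE => /le_trans.
    by apply; exact: corner_parent.
  rewrite -mulr_suml -inner_volumeS mulrC ler_wpM2l ?(mulr_ge0 (sqrtr_ge0 _) (mesh_ge0 _)) //.
  exact: inner_volume_le_total.
apply: le_trans (ler_norm_sum _ _ _) _; apply: ler_sum => c _.
rewrite B1_normrE B1_normZ ger0_norm ?exprn_ge0 ?mesh_ge0 // -[leRHS]mulr1.
apply: ler_wpM2l; first by rewrite exprn_ge0 ?mesh_ge0.
by have := elementary_norm_le (corner c) (unit_nvector R n); rewrite mass_unit_nvector.
Qed.

Definition inner_volume_lim X : R := limn (inner_volume X).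

Lemma inner_volume_cvg X : inner_volume X k @[k --> \oo] --> inner_volume_lim X.
Proof.
apply: nondecreasing_is_cvgn.
  by apply/nondecreasing_seqP => k; exact: inner_volume_incr.
by exists ((2 * M) ^+ n) => _ [k _ <-]; exact: inner_volume_le_total.
Qed.

(** The step bound is an increment of the potential [psi], inner volume minus a
    multiple of [mesh], which increases to a finite limit. *)
Lemma inner_chain_cauchy X : inner_chain X \in @cauchy_pred R (dirac_chain R n n).
Proof.
(* The factor 2 is the sum of the geometric series of meshes. *)
pose c := Num.sqrt n%:R * (2 * M) ^+ n * 2.
pose psi k := inner_volume X k - c * mesh k.
have step k : `|inner_chain X k.+1 - inner_chain X k| <= psi k.+1 - psi k.
  apply: le_trans (inner_chain_step X k) _; rewrite /psi [mesh k]meshS /c.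
  move: (Num.sqrt _) ((2 * M) ^+ n) (mesh k.+1) (inner_volume _ _) (inner_volume _ _) => *.
  lra.
have psi_le k d : `|inner_chain X (d + k)%N - inner_chain X k| <= psi (d + k)%N - psi k.
  elim: d => [|d IH]; first by rewrite add0n !subrr normr0.
  have := ler_distD (inner_chain X (d + k)%N) (inner_chain X (d.+1 + k)%N) (inner_chain X k).
  have := step (d + k)%N; rewrite addSn; lra.
have psi_cvg : psi k @[k --> \oo] --> inner_volume_lim X - c * 0.
  apply: cvgB; first exact: inner_volume_cvg.
  apply: cvgMl_tmp; apply/cvgn_dist => e /mesh_small[N HN]; exists N => k Nk.
  by rewrite subr0 gtr0_norm ?mesh_gt0 ?HN.
apply/asboolP => e e0.
have /cvgn_dist/(_ (e / 2)) := psi_cvg; rewrite divr_gt0 // => /(_ isT)[N HN].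
suff H i j : (N <= i)%N -> (i <= j)%N -> `|inner_chain X j - inner_chain X i| < e.
  exists N => i j Ni Nj; have [ij|/ltnW ji] := leqP i j; last exact: H.
  by rewrite distrC H.
move=> Ni ij; rewrite -(subnK ij); apply: le_lt_trans (psi_le _ _) _.
rewrite subnK //; have := HN i Ni; have := HN j (leq_trans Ni ij).
by rewrite !ltr_norml; move: (_ - c * 0) => l; lra.
Qed.

Definition inner_limit X : differential_chain R n n :=
  cauchy_class (CauchySeq (inner_chain_cauchy X)).

Lemma inner_limit_cvg X (w : {scalar dirac_chain R n n}) : bounded_lipschitz w ->
  w (inner_chain X k) @[k --> \oo] --> chain_integral (inner_limit X) w.
Proof.
move=> bw; apply: (chain_integral_cvg bw).
exact: (to_completion_cvg (CauchySeq (inner_chain_cauchy X))).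
Qed.

Lemma inner_chain_form X k (w : {scalar dirac_chain R n n}) :
  w (inner_chain X k) =
  \sum_(z : cell_index k | cell_in X z) mesh k ^+ n * top_coeff w (corner z).
Proof. by rewrite linear_sum; apply: eq_bigr => z _; rewrite linearZ. Qed.

End Grid.

(** * Counting grid points in boxes *)

Section Counting.
Variable R : realType.

(** The count is the ceiling of [x] clamped to [[0, m]]; these bounds, free of
    roundings, are all that volume estimates need. *)
Lemma count_below (m : nat) (x : R) :
  Num.min x m%:R <= \sum_(j < m) ((j%:R < x)%R)%:R <= Num.max (x + 1) 0 /\
  \sum_(j < m) ((j%:R < x)%R)%:R <= m%:R :> R.
Proof.
have sm l : \sum_(j < l) ((j%:R < x)%R)%:R <= l%:R :> R.
  rewrite -[l in leRHS]card_ord -sumr_const; apply: ler_sum => j _.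
  by case: (_ < x).
split=> //; elim: m => [|m IH]; first by rewrite big_ord0 ge_min le_max !lexx !orbT.
rewrite big_ord_recr /=; have := sm m; move: (\sum_(j < m) _) IH => S.
rewrite -natr1 !ge_min !le_max => /andP[H1 H2] H3.
have [mx|xm] := ltrP m%:R x => /=.
  have {}H1 : m%:R <= S by case/orP: H1 => //; exact: (le_trans (ltW mx)).
  by apply/andP; split; apply/orP; [right|left]; lra.
rewrite addr0; apply/andP; split=> //; apply/orP; left.
by case/orP: H1 => // /(le_trans xm).
Qed.

End Counting.

Section BoxSampling.
Variables (R : realType) (n : nat) (M : R).
Hypothesis M0 : 0 < M.
Implicit Types a b : 'rV[R]_n.

Definition segment_sample k (x y : R) : R :=
  mesh M k * \sum_(j < 2 ^ k) ((x <= node M k j < y)%R)%:R.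

Lemma ico_indicator (x y t : R) : x <= y ->
  ((x <= t < y)%R)%:R = ((t < y)%R)%:R - ((t < x)%R)%:R :> R.
Proof.
move=> xy; have [xt|tx] := leP x t; first by rewrite subr0.
by rewrite (lt_le_trans tx xy) subrr.
Qed.

(** A segment loses or gains at most one node at its ends; the lower bound needs
    the segment to lie inside the grid. *)
Lemma segment_sample_bounds k (x y : R) : x <= y ->
  segment_sample k x y <= y - x + mesh M k /\
  (- M <= x -> y <= M -> y - x - mesh M k <= segment_sample k x y).
Proof.
move=> xy; have h0 := mesh_gt0 M0 k; rewrite /segment_sample.
have E (t : R) : \sum_(j < 2 ^ k) ((node M k j < t)%R)%:R =
    \sum_(j < 2 ^ k) ((j%:R < (t + M) / mesh M k)%R)%:R :> R.
  apply: eq_bigr => j _; congr (nat_of_bool _)%:R.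
  by rewrite ltr_pdivlMr // /node mulrC; apply/idP/idP; lra.
under eq_bigr do rewrite ico_indicator //.
rewrite sumrB !E; set u := (x + M) / _; set v := (y + M) / _.
have uv : v - u = (y - x) / mesh M k by rewrite /u /v; field; rewrite lt0r_neq0.
have full : (2 ^ k)%:R = 2 * M / mesh M k :> R.
  rewrite natrX; apply: (canRL (mulfK (lt0r_neq0 h0))).
  by rewrite /mesh mulrC divfK // lt0r_neq0 // exprn_gt0.
have [/andP[v1 v2] v3] := count_below (2 ^ k) v.
have [/andP[u1 u2] u3] := count_below (2 ^ k) u.
have uv0 : 0 <= v - u by rewrite uv divr_ge0 ?subr_ge0 ?(ltW h0).
set cv := \sum_(j < _) _ in v1 v2 v3 *; set cu := \sum_(j < _) _ in u1 u2 u3 *.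
have cu0 : 0 <= cu by apply: sumr_ge0.
rewrite -[X in _ <= X + _ /\ _](divfK (lt0r_neq0 h0)) -uv.
split.
  suff : cv - cu <= v - u + 1 by rewrite -(ler_pM2l h0); lra.
  move: v2 u1; rewrite le_max ge_min => /orP[|] v2 /orP[|] u1; lra.
move=> Mx yM.
have u0 : 0 <= u by rewrite divr_ge0 ?(ltW h0) //; lra.
have vm : v <= (2 ^ k)%:R by rewrite full ler_pM2r ?invr_gt0 //; lra.
suff : v - u - 1 <= cv - cu.
  rewrite -(ler_pM2l h0) (_ : y - x = mesh M k * (v - u)); first lra.
  by rewrite uv mulrC divfK ?lt0r_neq0.
move: v1 u2; rewrite le_max ge_min => /orP[|] v1 /orP[|] u2; lra.
Qed.

(** Boxes are half-open so that those of a subdivision have disjoint traces on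
    the grid; the product form makes the count factor over the coordinates. *)
Definition box_indicator a b (x : 'rV[R]_n) : R :=
  \prod_i ((a 0 i <= x 0 i < b 0 i)%R)%:R.

Definition box_sample k a b : R :=
  \sum_(z : cell_index n k) mesh M k ^+ n * box_indicator a b (corner M z).

Lemma box_indicatorE a b x :
  box_indicator a b x = `[< forall i, a 0 i <= x 0 i < b 0 i >]%:R.
Proof.
rewrite /box_indicator; case: asboolP => H; first by rewrite big1 // => i _; rewrite H.
have [i Hi] : exists i, ~~ (a 0 i <= x 0 i < b 0 i).
  by apply: contrapT => /forallNP H'; apply: H => i; apply/negPn/negP/H'.
by rewrite (bigD1 i) //= (negbTE Hi) mul0r.
Qed.

Lemma box_sample_prod k a b :
  box_sample k a b = \prod_i segment_sample k (a 0 i) (b 0 i).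
Proof.
rewrite /segment_sample.
under eq_bigr do rewrite mulr_sumr.
rewrite bigA_distr_bigA; apply: eq_bigr => z _.
rewrite big_split /= prodr_const card_ord; congr (_ * _).
by apply: eq_bigr => i _; rewrite !mxE.
Qed.

Lemma segment_sample_ge0 k x y : 0 <= segment_sample k x y.
Proof. by rewrite mulr_ge0 ?(mesh_ge0 M0) // sumr_ge0. Qed.

Lemma box_indicator_ge0 a b x : 0 <= box_indicator a b x.
Proof. by apply: prodr_ge0. Qed.

Lemma segment_sample_cvg x y : - M <= x -> x <= y -> y <= M ->
  segment_sample k x y @[k --> \oo] --> y - x.
Proof.
move=> Mx xy yM; apply/cvgn_dist => e /(mesh_small M0)[N HN]; exists N => k Nk.
have [H1 H2] := segment_sample_bounds k xy; have := H2 Mx yM.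
by rewrite ltr_norml; have := HN k Nk; move=> *; apply/andP; split; lra.
Qed.

Lemma box_sample_cvg a b : (forall i, [/\ - M <= a 0 i, a 0 i <= b 0 i & b 0 i <= M]) ->
  box_sample k a b @[k --> \oo] --> \prod_i (b 0 i - a 0 i).
Proof.
move=> ab; under eq_fun do rewrite box_sample_prod.
apply: cvg_big => [|i _]; first by move=> x; apply: mul_continuous.
by have [] := ab i; exact: segment_sample_cvg.
Qed.

End BoxSampling.

(** * Riemann integrals over cubes *)

Section CubeIntegral.
Variables (R : realType) (n : nat) (M : R).
Hypothesis M0 : 0 < M.
Implicit Types (a b : 'rV[R]_n) (Q : 'rV[R]_n * R).

Definition in_base Q : Prop := forall i, - M <= Q.1 0 i /\ Q.1 0 i + Q.2 <= M.

Definition grid_sample (f : 'rV[R]_n -> R) k a b : R :=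
  \sum_(z : cell_index n k) mesh M k ^+ n * (f (corner M z) * box_indicator a b (corner M z)).

Lemma inner_volume_indicator X k :
  inner_volume M X k = \sum_(z : cell_index n k) mesh M k ^+ n * (cell_in M X z)%:R.
Proof.
rewrite /inner_volume big_mkcond; apply: eq_bigr => z _.
by case: ifP => _; rewrite ?mulr1 ?mulr0.
Qed.

Lemma inner_chain_indicator X k (w : {scalar dirac_chain R n n}) :
  w (inner_chain M X k) = \sum_(z : cell_index n k)
    mesh M k ^+ n * (top_coeff w (corner M z) * (cell_in M X z)%:R).
Proof.
rewrite inner_chain_form big_mkcond; apply: eq_bigr => z _.
by case: ifP => _; rewrite ?mulr1 ?mulr0.
Qed.

(** The corners of the inner cells of a cube are nodes of a box of side [Q.2] and
    include those of a box of side [Q.2 - mesh]; node counts in boxes are products. *)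
Lemma cell_in_cube_le Q k (z : cell_index n k) :
  (cell_in M (closed_cube Q) z)%:R <=
    box_indicator Q.1 (Q.1 + const_mx Q.2) (corner M z) :> R.
Proof.
rewrite box_indicatorE ler_nat; case: (boolP (cell_in _ _ _)) => // /asboolP zQ.
have h0 := mesh_gt0 M0 k; rewrite asboolT // => i; rewrite !mxE.
have := zQ _ (corner_in M0 z) i; rewrite !mxE => /andP[-> _] /=.
have /zQ/(_ i) : closed_cube (cell M z) (corner M z + const_mx (mesh M k)).
  by move=> j; rewrite /= !mxE lexx andbT lerDl ltW.
by rewrite !mxE => /andP[_]; lra.
Qed.

Lemma le_cell_in_cube Q k (z : cell_index n k) :
  box_indicator Q.1 (Q.1 + const_mx (Q.2 - mesh M k)) (corner M z) <=
    (cell_in M (closed_cube Q) z)%:R :> R.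
Proof.
rewrite box_indicatorE ler_nat; case: asboolP => // zQ.
rewrite /cell_in asboolT // => x xz i; have := zQ i; have := xz i; rewrite /= !mxE.
by move=> /andP[? ?] /andP[? ?]; apply/andP; split; lra.
Qed.

Lemma inner_volume_cube_le Q k :
  inner_volume M (closed_cube Q) k <= box_sample M k Q.1 (Q.1 + const_mx Q.2).
Proof.
rewrite inner_volume_indicator; apply: ler_sum => z _; apply: ler_wpM2l.
  by rewrite exprn_ge0 ?(mesh_ge0 M0).
exact: cell_in_cube_le.
Qed.

Lemma box_sample_cube_cvg Q : 0 <= Q.2 -> in_base Q ->
  box_sample M k Q.1 (Q.1 + const_mx Q.2) @[k --> \oo] --> Q.2 ^+ n.
Proof.
move=> Q0 bQ; rewrite -[n in _ ^+ n]card_ord -prodr_const.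
rewrite (eq_bigr (fun i => (Q.1 + const_mx Q.2) 0 i - Q.1 0 i)); last first.
  by move=> i _; rewrite !mxE addrAC subrr add0r.
apply: (box_sample_cvg M0) => i; have [? ?] := bQ i.
by rewrite !mxE; split=> //; lra.
Qed.

Lemma inner_volume_cube_cvg Q : 0 < Q.2 -> in_base Q ->
  inner_volume M (closed_cube Q) k @[k --> \oo] --> Q.2 ^+ n.
Proof.
move=> Q0 bQ.
apply: (@squeeze_cvgr _ _ _ _ (fun k => (Q.2 - 2 * mesh M k) ^+ n)
   (fun k => box_sample M k Q.1 (Q.1 + const_mx Q.2))); last 2 first.
- rewrite (_ : Q.2 ^+ n = (Q.2 - 2 * 0) ^+ n); last by rewrite mulr0 subr0.
  apply: cvgn_exp.
  apply: cvgB; first exact: cvg_cst.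
  apply: cvgMl_tmp; apply/cvgn_dist => e /(mesh_small M0)[N HN]; exists N => k Nk.
  by rewrite subr0 gtr0_norm ?(mesh_gt0 M0) ?HN.
- exact: box_sample_cube_cvg (ltW Q0) bQ.
have [N HN] := mesh_small M0 (divr_gt0 Q0 (ltr0n R 2)).
exists N => // k /= /HN hk; rewrite inner_volume_cube_le andbT.
have h0 := mesh_gt0 M0 k.
apply: (@le_trans _ _ (box_sample M k Q.1 (Q.1 + const_mx (Q.2 - mesh M k)))); last first.
  rewrite inner_volume_indicator; apply: ler_sum => z _; apply: ler_wpM2l.
    by rewrite exprn_ge0 ?(mesh_ge0 M0).
  exact: le_cell_in_cube.
rewrite box_sample_prod -[n in _ ^+ n]card_ord -prodr_const; apply: ler_prod => i _.
rewrite !mxE; apply/andP; split; first lra.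
have [b1 b2] := bQ i.
have xy : Q.1 0 i <= Q.1 0 i + (Q.2 - mesh M k) by lra.
by have [_ H] := segment_sample_bounds M0 k xy; have := H b1; lra.
Qed.

(** In each coordinate the indicators of the pieces of a subdivision telescope
    to that of the whole side. *)
Lemma box_indicator_partition a b m (P : 'I_n -> nat -> R) (x : 'rV[R]_n) :
  grid_partition a b m P -> box_indicator a b x =
  \sum_(c : {ffun 'I_n -> 'I_m})
    box_indicator (\row_i P i (c i)) (\row_i P i (c i).+1) x.
Proof.
move=> gP; pose F i (j : 'I_m) : R := ((P i j <= x 0 i < P i j.+1)%R)%:R.
transitivity (\prod_i \sum_j F i j); last first.
  rewrite bigA_distr_bigA; apply: eq_bigr => c _.
  by apply: eq_bigr => i _; rewrite /F !mxE.
apply: eq_bigr => i _; have [P0 Pm Pj] := gP i.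
have incr j : (j <= m)%N -> P i 0%N <= P i j.
  elim: j => // j IH jm; exact: le_trans (IH (ltnW jm)) (Pj _ jm).
rewrite -P0 -Pm ico_indicator ?incr //.
rewrite -(telescope_sumr (fun j => ((x 0 i < P i j)%R)%:R) (leq0n m)) big_mkord.
by apply: eq_bigr => j _; rewrite /F ico_indicator // Pj.
Qed.

(** Each node lies in exactly one piece of the partition, where [f] differs from
    its value at the tag by at most the Lipschitz constant times the diameter. *)
Lemma grid_sample_riemann_sum (f : 'rV[R]_n -> R) (C : R) k a b m P t (d : R) :
  0 <= C -> 0 <= d -> (forall p q, `|f p - f q| <= C * enorm (p - q)) ->
  grid_partition a b m P -> tags_in_cells P t ->
  (forall i j, (j < m)%N -> P i j.+1 - P i j < d) ->
  `|grid_sample f k a b - \sum_(c : {ffun 'I_n -> 'I_m})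
      f (t c) * box_sample M k (\row_i P i (c i)) (\row_i P i (c i).+1)| <=
  C * (Num.sqrt n%:R * d) * box_sample M k a b.
Proof.
move=> C0 d0 fC gP tP Pd; rewrite /grid_sample /box_sample.
under [X in _ - X]eq_bigr do rewrite mulr_sumr.
rewrite [X in _ - X]exchange_big -sumrB mulr_sumr /=.
apply: le_trans (ler_norm_sum _ _ _) _; apply: ler_sum => z _.
under eq_bigr do rewrite mulrCA.
rewrite -mulr_sumr -mulrBr normrM ger0_norm ?exprn_ge0 ?(mesh_ge0 M0) //.
rewrite [leRHS]mulrCA ler_wpM2l ?exprn_ge0 ?(mesh_ge0 M0) //.
rewrite (box_indicator_partition _ gP) !mulr_sumr -sumrB.
apply: le_trans (ler_norm_sum _ _ _) _; apply: ler_sum => c _.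
rewrite -mulrBl normrM (ger0_norm (box_indicator_ge0 _ _ _)).
rewrite box_indicatorE; case: asboolP => H; last by rewrite !mulr0.
rewrite !mulr1; apply: le_trans (fC _ _) _; apply: ler_wpM2l => //.
apply: enorm_le => // i; have := H i; have := tP c i; have := Pd i _ (ltn_ord (c i)).
rewrite !mxE => ? /andP[? ?] /andP[? ?]; rewrite ler_norml; apply/andP; split; lra.
Qed.

(** Keeping all nodes of the cube instead of the corners of its inner cells changes
    the sums by boundary nodes only, whose total volume vanishes in the limit. *)
Lemma grid_sample_cvg Q (w : {scalar dirac_chain R n n}) :
  0 < Q.2 -> in_base Q -> bounded_lipschitz w ->
  grid_sample (top_coeff w) k Q.1 (Q.1 + const_mx Q.2) @[k --> \oo] -->
    chain_integral (inner_limit M0 (closed_cube Q)) w.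
Proof.
move=> Q0 bQ bw; have [C C0 wC] := top_coeff_bounded bw.
have cw := @inner_limit_cvg R n M M0 (closed_cube Q) w bw.
set l := chain_integral _ _ in cw *.
rewrite (_ : (fun k => _) = fun k => (grid_sample (top_coeff w) k Q.1 (Q.1 + const_mx Q.2) -
   w (inner_chain M (closed_cube Q) k)) + w (inner_chain M (closed_cube Q) k)); last first.
  by apply/funext => k; rewrite subrK.
rewrite -[X in _ --> X]add0r; apply: cvgD => //; apply/norm_cvg0P.
apply: (@squeeze_cvgr _ _ _ _ (fun=> 0) (fun k => C *
  (box_sample M k Q.1 (Q.1 + const_mx Q.2) - inner_volume M (closed_cube Q) k))).
- apply: nearW => k; rewrite normr_ge0 /= inner_chain_indicator inner_volume_indicator.
  rewrite /grid_sample /box_sample -!sumrB mulr_sumr.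
  apply: le_trans (ler_norm_sum _ _ _) _; apply: ler_sum => z _.
  rewrite -!mulrBr normrM ger0_norm ?exprn_ge0 ?(mesh_ge0 M0) //.
  rewrite [leRHS]mulrCA ler_wpM2l ?exprn_ge0 ?(mesh_ge0 M0) //.
  have zQ := cell_in_cube_le Q z.
  by rewrite normrM (ger0_norm (_ : 0 <= _ - _)) ?subr_ge0 // ler_wpM2r ?subr_ge0 // (wC _).1.
- exact: cvg_cst.
- rewrite -(mulr0 C) -(subrr (Q.2 ^+ n)); apply: cvgMl_tmp; apply: cvgB.
    exact: box_sample_cube_cvg (ltW Q0) bQ.
  exact: inner_volume_cube_cvg.
Qed.

(** Sampling on finer and finer grids compares the limit with any fixed tagged
    partition: grid counts in the pieces tend to their volumes. *)
Lemma riemann_integral_cube Q (w : {scalar dirac_chain R n n}) :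
  0 < Q.2 -> in_base Q -> bounded_lipschitz w ->
  has_riemann_integral (top_coeff w) Q.1 (Q.1 + const_mx Q.2)
    (chain_integral (inner_limit M0 (closed_cube Q)) w).
Proof.
move=> Q0 bQ bw; have [C C0 wC] := top_coeff_bounded bw.
have cw := grid_sample_cvg Q0 bQ bw; set l := chain_integral _ _ in cw *.
move=> e e0; pose c := C * Num.sqrt n%:R * Q.2 ^+ n.
have c0 : 0 <= c by rewrite !mulr_ge0 ?sqrtr_ge0 // exprn_ge0 // ltW.
exists (e / (c + 1)) => [|m P t gP tP Pd]; first by rewrite divr_gt0 ?ltr_wpDl.
set d := e / _ in Pd; have d0 : 0 <= d by rewrite divr_ge0 ?addr_ge0 ?(ltW e0).
pose lo (x : {ffun 'I_n -> 'I_m}) := \row_i P i (x i).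
pose hi (x : {ffun 'I_n -> 'I_m}) := \row_i P i (x i).+1.
have incr i j1 j2 : (j1 <= j2)%N -> (j2 <= m)%N -> P i j1 <= P i j2.
  move=> j12; rewrite -(subnK j12); elim: (j2 - j1)%N => // j IH jm.
  by have [_ _ Pj] := gP i; apply: le_trans (IH (ltnW jm)) (Pj _ jm).
have cs : (fun k => \sum_x top_coeff w (t x) * box_sample M k (lo x) (hi x)) @ \oo -->
    riemann_sum (top_coeff w) P t.
  apply: cvg_big => [|x _]; first by move=> x; apply: add_continuous.
  apply: cvgMl_tmp.
  rewrite (eq_bigr (fun i => hi x 0 i - lo x 0 i)) => [|i _]; last by rewrite !mxE.
  apply: (box_sample_cvg M0) => i; rewrite !mxE.
  have [P0 Pm _] := gP i; have [b1 b2] := bQ i; rewrite !mxE in Pm.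
  split; last 1 first.
  - by rewrite (le_trans _ b2) // -Pm incr.
  - by rewrite (le_trans b1) // -P0 incr // ltnW.
  - by rewrite incr.
have cd : (fun k => `|grid_sample (top_coeff w) k Q.1 (Q.1 + const_mx Q.2) -
    \sum_x top_coeff w (t x) * box_sample M k (lo x) (hi x)|) @ \oo -->
    `|l - riemann_sum (top_coeff w) P t|.
  by apply: cvg_norm; apply: cvgB.
have cb : (fun k => C * (Num.sqrt n%:R * d) * box_sample M k Q.1 (Q.1 + const_mx Q.2))
    @ \oo --> C * (Num.sqrt n%:R * d) * Q.2 ^+ n.
  by apply: cvgMl_tmp; exact: box_sample_cube_cvg (ltW Q0) bQ.
have : `|l - riemann_sum (top_coeff w) P t| <= C * (Num.sqrt n%:R * d) * Q.2 ^+ n.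
  rewrite -(cvg_lim _ cd) // -(cvg_lim _ cb) //.
  apply: ler_lim; [by apply/cvg_ex; eexists; exact: cd|by apply/cvg_ex; eexists; exact: cb|].
  apply: nearW => k; apply: (grid_sample_riemann_sum k C0 d0 _ gP tP Pd).
  by move=> p q; have [_ H] := wC p; exact: H.
rewrite distrC => /le_lt_trans; apply.
rewrite (_ : _ * _ = c * d); last by rewrite /c; ring.
by rewrite /d mulrA ltr_pdivrMr ?ltr_wpDl // mulrC ltr_pM2l // ltrDl.
Qed.

End CubeIntegral.

(** * Exhausting a set by non-overlapping cubes *)

Section Exhaustion.
Variables (R : realType) (n : nat) (M : R).
Hypothesis M0 : 0 < M.
Implicit Types (U X : set 'rV[R]_n) (Q : 'rV[R]_n * R).

Lemma closed_cube_compact Q : compact (closed_cube Q).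
Proof.
rewrite (_ : closed_cube Q = [set v : 'rV[R]_n | forall i,
    `[Q.1 0 i, (Q.1 0 i + Q.2)]%classic (v ord0 i)]); last first.
  by apply/seteqP; split=> v H i; have := H i; rewrite /= in_itv.
by apply: (@rV_compact _ _ (fun i => `[Q.1 0 i, (Q.1 0 i + Q.2)]%classic)) => i; exact: segment_compact.
Qed.

Definition center Q : 'rV[R]_n := Q.1 + const_mx (Q.2 / 2).

(** Balls of the sup norm are cubes: [ball (center Q) (r * (Q.2 / 2))] is the open
    concentric cube with side [r * Q.2]. *)
Lemma closed_cube_sub_ball Q (r : R) : 0 < Q.2 -> 1 < r ->
  closed_cube Q `<=` ball (center Q) (r * (Q.2 / 2)).
Proof.
move=> Q0 r1 x xQ; rewrite -ball_normE /=.
have s0 : 0 < r * (Q.2 / 2) by rewrite mulr_gt0 ?divr_gt0 //; lra.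
have rs : Q.2 / 2 < r * (Q.2 / 2) by rewrite ltr_pMl // divr_gt0.
apply: norm_lt => // i; have := xQ i; rewrite !mxE => /andP[? ?].
by rewrite ltr_norml; move: (r * _) rs => *; apply/andP; split; lra.
Qed.

Lemma ball_sub_box Q (r : R) x : ball (center Q) (r * (Q.2 / 2)) x ->
  box_indicator (center Q - const_mx (r * (Q.2 / 2))) (center Q + const_mx (r * (Q.2 / 2))) x
    = 1 :> R.
Proof.
rewrite -ball_normE /= => xQ; rewrite box_indicatorE asboolT // => i.
have := le_lt_trans (coord_le_norm _ i) xQ; rewrite !mxE ltr_norml.
by move: (r * _) => h /andP[? ?]; apply/andP; split; lra.
Qed.

(** Refining the grid inside the cells of level [k] keeps their total volume, while a
    box with sides [l q] contains nodes of total volume at most [(l q + mesh) ^ n]. *)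
Lemma inner_volume_le_cover X k (I : eqType) (s : seq I) (a b : I -> 'rV[R]_n) (l : I -> R) :
  (forall q, q \in s -> 0 <= l q /\ forall i, b q 0 i - a q 0 i = l q) ->
  (forall x, (exists2 z : cell_index n k, cell_in M X z & closed_cube (cell M z) x) ->
     exists2 q, q \in s & box_indicator (a q) (b q) x = 1) ->
  inner_volume M X k <= \sum_(q <- s) l q ^+ n.
Proof.
move=> sl scov.
pose K := [set x | exists2 z : cell_index n k, cell_in M X z & closed_cube (cell M z) x].
have step j : inner_volume M X k <= \sum_(q <- s) (l q + mesh M (j + k)) ^+ n.
  apply: (@le_trans _ _ (inner_volume M K (j + k)%N)).
    elim: j => [|j IH]; last exact: le_trans IH (inner_volume_incr M0 _ _).
    rewrite add0n /inner_volume [leRHS](bigID (fun z => cell_in M X z)) /=.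
    rewrite -[leLHS]addr0 lerD ?sumr_ge0 // => [|z _]; last by rewrite exprn_ge0 ?(mesh_ge0 M0).
    rewrite le_eqVlt; apply/orP; left; apply/eqP; apply: eq_bigl => z.
    by rewrite andb_idl // => zX; apply/asboolP => x xz; exists z.
  apply: (@le_trans _ _ (\sum_(q <- s) box_sample M (j + k) (a q) (b q))); last first.
    rewrite big_seq [leRHS]big_seq; apply: ler_sum => q qs.
    have [l0 lE] := sl q qs.
    rewrite box_sample_prod -[n in _ ^+ n]card_ord -prodr_const; apply: ler_prod => i _.
    rewrite (segment_sample_ge0 M0) /= -(lE i).
    have le_ab : (a q) 0 i <= (b q) 0 i by rewrite -subr_ge0 lE.
    by have [] := segment_sample_bounds M0 (j + k) le_ab.
  rewrite inner_volume_indicator /box_sample exchange_big /=; apply: ler_sum => z _.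
  rewrite -mulr_sumr; apply: ler_wpM2l; first by rewrite exprn_ge0 ?(mesh_ge0 M0).
  have s0 : 0 <= \sum_(q <- s) box_indicator (a q) (b q) (corner M z).
    by apply: sumr_ge0 => q _; exact: box_indicator_ge0.
  case: (boolP (cell_in M K z)) => // /asboolP/(_ _ (corner_in M0 z))/scov[q qs q1].
  rewrite -q1 (big_rem q) //= lerDl.
  by apply: sumr_ge0 => q' _; exact: box_indicator_ge0.
have cv : (fun j => \sum_(q <- s) (l q + mesh M (j + k)) ^+ n) @ \oo -->
    \sum_(q <- s) (l q + 0) ^+ n.
  apply: cvg_big => [|q _]; first by move=> x; apply: add_continuous.
  apply: cvgn_exp; apply: cvgD; first exact: cvg_cst.
  apply/cvgn_dist => e /(mesh_small M0)[N HN]; exists N => j Nj.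
  by rewrite subr0 gtr0_norm ?(mesh_gt0 M0) ?HN // (leq_trans Nj) // leq_addr.
under eq_bigr do rewrite -[l _]addr0.
rewrite -(cvg_lim _ cv) //; apply: limr_ge; first by apply/cvg_ex; eexists; exact: cv.
exact: nearW.
Qed.

(** A finite union of grid cells inside [U] is compact, so finitely many slightly
    enlarged cubes of the covering family cover it. *)
Lemma finite_subcover_volume U (D : set ('rV[R]_n * R)) k (r : R) :
  (forall Q, D Q -> 0 < Q.2) -> U `<=` \bigcup_(Q in D) closed_cube Q -> 1 < r ->
  exists2 s : seq ('rV[R]_n * R), uniq s /\ (forall Q, Q \in s -> D Q) &
    inner_volume M U k <= r ^+ n * \sum_(Q <- s) Q.2 ^+ n.
Proof.
move=> D0 UD r1.
have cov z : exists s : seq ('rV[R]_n * R), (forall Q, Q \in s -> D Q) /\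
   (cell_in M U z -> closed_cube (cell M (z : cell_index n k)) `<=`
     [set x | exists2 Q, Q \in s & ball (center Q) (r * (Q.2 / 2)) x]).
  have [zU|zU] := boolP (cell_in M U z); last by exists [::].
  have := @closed_cube_compact (cell M z).
  rewrite compact_cover => /(_ _ D (fun Q => ball (center Q) (r * (Q.2 / 2)))).
  case=> [Q DQ|x xz|F FD Fcov]; first exact: ball_open.
    move/asboolP: zU => /(_ x xz)/UD[Q DQ xQ]; exists Q => //.
    by apply: closed_cube_sub_ball => //; exact: D0.
  exists (finmap.enum_fset F); split=> [Q QF|_ x /Fcov[Q QF xQ]]; last by exists Q.
  by have := FD Q QF; rewrite inE.
have [g Hg] := choice cov.
pose s := undup (flatten [seq g z | z <- enum (cell_index n k)]).
have sD Q : Q \in s -> D Q.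
  rewrite mem_undup => /flattenP[_ /mapP[z _ ->]]; exact: (Hg z).1.
exists s; first by split; [exact: undup_uniq|exact: sD].
rewrite mulr_sumr (eq_bigr (fun Q => (r * Q.2) ^+ n)) => [|Q _]; last by rewrite exprMn.
apply: (inner_volume_le_cover (a := fun Q => center Q - const_mx (r * (Q.2 / 2)))
  (b := fun Q => center Q + const_mx (r * (Q.2 / 2)))) => [Q /sD/D0 Q0|x [z zU xz]].
  by split=> [|i]; [rewrite mulr_ge0 ?(ltW Q0) //; lra|rewrite !mxE; field].
have [Q Qg /ball_sub_box xQ] := (Hg z).2 zU x xz; exists Q => //.
by rewrite mem_undup; apply/flattenP; exists (g z) => //; apply: map_f; rewrite mem_enum.
Qed.

(** The center of a cell inside two cubes would be interior to both. *)
Lemma disjoint_cubes_cell_count (s : seq ('rV[R]_n * R)) X k (z : cell_index n k) : uniq s ->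
  (forall Q, Q \in s -> closed_cube Q `<=` X) ->
  (forall Q Q', Q \in s -> Q' \in s -> Q <> Q' -> open_cube Q `&` open_cube Q' = set0) ->
  \sum_(Q <- s) (cell_in M (closed_cube Q) z)%:R <= (cell_in M X z)%:R :> R.
Proof.
move=> us sX sI.
(* An upper corner of a cell may lie on the boundary, its center may not. *)
have mid Q : cell_in M (closed_cube Q) z -> open_cube Q (center (cell M z)).
  move=> /asboolP zQ i; have h0 := mesh_gt0 M0 k.
  have := zQ _ (corner_in M0 z) i.
  have /zQ/(_ i) : closed_cube (cell M z) (corner M z + const_mx (mesh M k)).
    by move=> j; rewrite /= !mxE lexx andbT lerDl ltW.
  by rewrite /= !mxE /= => /andP[? ?] /andP[? ?]; apply/andP; split; lra.
have [/hasP[Q Qs zQ]|/hasPn no] := boolP (has (fun Q => cell_in M (closed_cube Q) z) s); last first.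
  by rewrite big_seq big1 ?ler0n // => Q /no /negbTE ->.
rewrite (bigD1_seq Q) //= zQ big_seq_cond big1 => [|Q' /andP[Q's Q'Q]].
  by rewrite addr0 (cell_in_sub (sX Q Qs) zQ).
case: (boolP (cell_in _ _ _)) => // zQ'; exfalso.
have QQ' : Q <> Q' by move=> E; rewrite E eqxx in Q'Q.
have : set0 (center (cell M z)) by rewrite -(sI Q Q' Qs Q's QQ'); split; exact: mid.
by [].
Qed.

(** By [disjoint_cubes_cell_count] the cells left over carry a nonnegative weight,
    so the bound on the form applies cell by cell. *)
Lemma inner_chain_remainder (s : seq ('rV[R]_n * R)) X k (w : {scalar dirac_chain R n n}) (C : R) :
  uniq s -> (forall Q, Q \in s -> closed_cube Q `<=` X) ->
  (forall Q Q', Q \in s -> Q' \in s -> Q <> Q' -> open_cube Q `&` open_cube Q' = set0) ->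
  0 <= C -> (forall p, `|top_coeff w p| <= C) ->
  `|w (inner_chain M X k) - \sum_(Q <- s) w (inner_chain M (closed_cube Q) k)| <=
  C * (inner_volume M X k - \sum_(Q <- s) inner_volume M (closed_cube Q) k).
Proof.
move=> us sX sI C0 wC.
pose rest (z : cell_index n k) : R :=
  (cell_in M X z)%:R - \sum_(Q <- s) (cell_in M (closed_cube Q) z)%:R.
have rest0 z : 0 <= rest z by rewrite subr_ge0 disjoint_cubes_cell_count.
have -> : inner_volume M X k - \sum_(Q <- s) inner_volume M (closed_cube Q) k =
    \sum_z mesh M k ^+ n * rest z.
  under eq_bigr do rewrite inner_volume_indicator.
  rewrite inner_volume_indicator exchange_big -sumrB /=.
  by apply: eq_bigr => z _; rewrite -mulr_sumr mulrBr.
have -> : w (inner_chain M X k) - \sum_(Q <- s) w (inner_chain M (closed_cube Q) k) =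
    \sum_z mesh M k ^+ n * (top_coeff w (corner M z) * rest z).
  under eq_bigr do rewrite inner_chain_indicator.
  rewrite inner_chain_indicator exchange_big -sumrB /=.
  by apply: eq_bigr => z _; rewrite -mulr_sumr -mulrBr -mulr_sumr -mulrBr.
rewrite mulr_sumr; apply: le_trans (ler_norm_sum _ _ _) _; apply: ler_sum => z _.
rewrite !normrM (ger0_norm (exprn_ge0 n (mesh_ge0 M0 k))) [leRHS]mulrCA.
by rewrite ler_wpM2l ?exprn_ge0 ?(mesh_ge0 M0) // (ger0_norm (rest0 z)) ler_wpM2r.
Qed.

(** Finitely many of the cubes capture all but a small part of the inner volume of
    [U], and a bounded form is small on the rest. As the limit is the chain of [U]
    alone, the sum is the same for all decompositions. *)
Lemma has_sum_cubes U (D : set ('rV[R]_n * R)) (w : {scalar dirac_chain R n n}) :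
  (forall Q, D Q -> 0 < Q.2) -> (forall Q, D Q -> in_base M Q) ->
  \bigcup_(Q in D) closed_cube Q = U ->
  (forall Q Q', D Q -> D Q' -> Q <> Q' -> open_cube Q `&` open_cube Q' = set0) ->
  bounded_lipschitz w ->
  has_sum D (fun Q => chain_integral (inner_limit M0 (closed_cube Q)) w)
    (chain_integral (inner_limit M0 U) w).
Proof.
move=> D0 DM DU DI bw e e0; have [C C0 wC] := top_coeff_bounded bw.
have cubeU Q : D Q -> closed_cube Q `<=` U by move=> DQ x xQ; rewrite -DU; exists Q.
set V := inner_volume_lim M U.
have remainder (s : seq ('rV[R]_n * R)) : uniq s -> (forall Q, Q \in s -> D Q) ->
  `|chain_integral (inner_limit M0 U) w -
     \sum_(Q <- s) chain_integral (inner_limit M0 (closed_cube Q)) w| <=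
  C * (V - \sum_(Q <- s) Q.2 ^+ n).
  move=> us sD.
  have c1 : (fun k => `|w (inner_chain M U k) - \sum_(Q <- s) w (inner_chain M (closed_cube Q) k)|)
      @ \oo --> `|chain_integral (inner_limit M0 U) w -
     \sum_(Q <- s) chain_integral (inner_limit M0 (closed_cube Q)) w|.
    apply: cvg_norm; apply: cvgB; first exact: inner_limit_cvg.
    apply: cvg_big => [|Q _]; first by move=> x; apply: add_continuous.
    exact: inner_limit_cvg.
  have c2 : (fun k => C * (inner_volume M U k - \sum_(Q <- s) inner_volume M (closed_cube Q) k))
      @ \oo --> C * (V - \sum_(Q <- s) Q.2 ^+ n).
    apply: cvgMl_tmp; apply: cvgB; first exact: inner_volume_cvg.
    rewrite big_seq; under eq_fun do rewrite big_seq.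
    apply: cvg_big => [|Q /sD DQ]; first by move=> x; apply: add_continuous.
    by apply: inner_volume_cube_cvg; [exact: M0|exact: D0|exact: DM].
  rewrite -(cvg_lim _ c1) // -(cvg_lim _ c2) //.
  apply: ler_lim; [by apply/cvg_ex; eexists; exact: c1|by apply/cvg_ex; eexists; exact: c2|].
  apply: nearW => k; apply: inner_chain_remainder => //.
  - by move=> Q /sD/cubeU.
  - by move=> Q Q' /sD DQ /sD DQ'; exact: DI.
  - by move=> p; exact: (wC p).1.
have [d d0 Cd] : exists2 d : R, 0 < d & C * d < e.
  exists (e / (C + 1)); first by rewrite divr_gt0 ?ltr_wpDl.
  by rewrite mulrA ltr_pdivrMr ?ltr_wpDl // mulrC ltr_pM2l // ltrDl.
have [k Hk] : exists k, V - d / 2 < inner_volume M U k.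
  have /cvgn_dist/(_ (d / 2)) := @inner_volume_cvg R n M M0 U.
  rewrite divr_gt0 // => /(_ isT)[N /(_ N (leqnn N))].
  by rewrite ltr_norml -/V => /andP[? _]; exists N; lra.
have [r r1 rV] : exists2 r : R, 1 < r & r ^+ n * (V - d) <= V - d / 2.
  have : ((1 + mesh M i) ^+ n * (V - d)) @[i --> \oo] --> (1 + 0) ^+ n * (V - d).
    apply: cvgMr_tmp; apply: cvgn_exp; apply: cvgD; first exact: cvg_cst.
    apply/cvgn_dist => a /(mesh_small M0)[N HN]; exists N => j Nj.
    by rewrite subr0 gtr0_norm ?(mesh_gt0 M0) ?HN.
  rewrite addr0 expr1n mul1r => /cvgn_dist/(_ (d / 2)).
  rewrite divr_gt0 // => /(_ isT)[N /(_ N (leqnn N))].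
  rewrite ltr_norml => /andP[_ H]; exists (1 + mesh M N); last lra.
  by rewrite ltrDl (mesh_gt0 M0).
have UD : U `<=` \bigcup_(Q in D) closed_cube Q by rewrite DU.
have [s [us sD] Hs] := finite_subcover_volume k D0 UD r1.
have sV : V - d <= \sum_(Q <- s) Q.2 ^+ n.
  have rn : 0 < r ^+ n by rewrite exprn_gt0 // (lt_trans ltr01).
  rewrite -(ler_pM2l rn); apply: le_trans rV _; apply: le_trans (ltW Hk) Hs.
exists [set` s]; split=> [||F Ff sF FD]; first exact: finite_seq.
  by move=> Q /sD.
rewrite fsbig_finite // distrC; apply: le_lt_trans (remainder _ (finmap.fset_uniq _) _) _.
  by move=> Q; rewrite in_fset_set // inE => /FD.
apply: le_lt_trans Cd; apply: ler_wpM2l => //.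
suff : \sum_(Q <- s) Q.2 ^+ n <= \sum_(Q <- finmap.enum_fset (fset_set F)) Q.2 ^+ n by lra.
have sub : {subset s <= finmap.enum_fset (fset_set F)}.
  by move=> Q Qs; rewrite in_fset_set // inE; exact: sF.
rewrite [leRHS](bigID (mem s)) /= -[leLHS]addr0 lerD //; last first.
  rewrite big_seq_cond sumr_ge0 // => Q /andP[QF _]; apply/exprn_ge0/ltW/D0/FD.
  by move: QF; rewrite in_fset_set // inE.
rewrite -[leRHS]big_filter le_eqVlt; apply/orP; left; apply/eqP; apply: perm_big; apply: uniq_perm => //.
  by rewrite filter_uniq // finmap.fset_uniq.
move=> Q; rewrite mem_filter; by case: (boolP (Q \in s)) => //= Qs; rewrite (sub Q Qs).
Qed.

End Exhaustion.

(** * Existence of Whitney decompositions *)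

Section Whitney.
Variables (R : realType) (n : nat) (M : R).
Hypothesis M0 : 0 < M.
Variable U : set 'rV[R]_n.
Hypothesis UM : forall x, U x -> `|x| < M.
Implicit Types (Q : 'rV[R]_n * R).

Lemma locate_node k (x : R) : - M <= x -> x <= M ->
  exists2 j, (j < 2 ^ k)%N & node M k j <= x <= node M k j + mesh M k.
Proof.
move=> Mx xM; elim: k => [|k [j jk /andP[j1 j2]]].
  by exists 0%N; rewrite // /node mesh0; apply/andP; split; lra.
have h0 := mesh_gt0 M0 k.+1.
have [xm|mx] := leP x (node M k j + mesh M k.+1).
  exists j.*2; first by rewrite expnS mul2n ltn_double.
  have := j1; have := xm; rewrite /node [mesh M k]meshS -(muln2 j) natrM.
  by move: j%:R => t *; apply/andP; split; lra.
exists j.*2.+1; first by rewrite expnS mul2n ltn_Sdouble.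
have := j2; have := mx; rewrite /node [mesh M k]meshS -(natr1 j.*2) -(muln2 j) natrM.
by move: j%:R => t *; apply/andP; split; lra.
Qed.

Lemma locate_cell k x : U x -> exists z : cell_index n k, closed_cube (cell M z) x.
Proof.
move=> Ux; have H i : exists j : 'I_(2 ^ k), node M k j <= x 0 i <= node M k j + mesh M k.
  have := le_lt_trans (coord_le_norm x i) (UM Ux); rewrite ltr_norml => /andP[x1 x2].
  by have [j jk Hj] := locate_node k (ltW x1) (ltW x2); exists (Ordinal jk).
by have [g Hg] := choice H; exists [ffun i => g i] => i; rewrite !mxE ffunE.
Qed.

(** Coarse nodes are fine nodes, so an open fine interval meeting an open coarse one
    is contained in it: the inequalities are between integers. *)
Lemma node_overlap k d a b (x : R) :
  node M k a < x < node M k a + mesh M k ->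
  node M (d + k) b < x < node M (d + k) b + mesh M (d + k) ->
  (2 ^ d * a <= b)%N /\ (b < 2 ^ d * a.+1)%N.
Proof.
have h0 := mesh_gt0 M0 (d + k); rewrite /node (mesh_pow M k d).
move=> /andP[a1 a2] /andP[b1 b2].
split; last first.
  rewrite -(ltr_nat R) -(ltr_pM2l h0) natrM natrX -(natr1 a) /=; lra.
rewrite -ltnS -(ltr_nat R) -(ltr_pM2l h0) natrM natrX -(natr1 b); lra.
Qed.

Lemma nested_cells k d (z : cell_index n k) (z' : cell_index n (d + k)) :
  open_cube (cell M z) `&` open_cube (cell M z') !=set0 ->
  closed_cube (cell M z') `<=` closed_cube (cell M z).
Proof.
move=> [x [xz xz']] y yz' i; have := xz i; have := xz' i; have := yz' i.
rewrite /= !mxE => yi H1 H2; have [ab ba] := node_overlap H2 H1.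
have h0 := mesh_gt0 M0 (d + k); move: yi; rewrite /node (mesh_pow M k d).
rewrite -(ler_nat R) natrM natrX -(ler_pM2l h0) in ab.
rewrite -(ler_nat R) natrM natrX -(ler_pM2l h0) -(natr1 (z i)) -(natr1 (z' i)) in ba.
by move=> /andP[y1 y2]; apply/andP; split; lra.
Qed.

Lemma overlapping_cells_eq k (z z' : cell_index n k) :
  open_cube (cell M z) `&` open_cube (cell M z') !=set0 -> z = z'.
Proof.
move=> [x [xz xz']]; apply/ffunP => i; apply/val_inj => /=.
have := xz i; have := xz' i; rewrite /= !mxE => H1 H2.
have [] := node_overlap (d := 0) H2 H1; rewrite expn0 !mul1n ltnS => ? ?.
by apply/eqP; rewrite eqn_leq; apply/andP; split.
Qed.

Lemma open_cell_parent k (c : cell_index n k.+1) :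
  open_cube (cell M c) `<=` open_cube (cell M (parent c)).
Proof.
move=> x xc i; have := xc i; rewrite /= !mxE ffunE /=.
by have [] := node_half M0 k (c i); move=> ? ? /andP[? ?]; apply/andP; split; lra.
Qed.

(** The condition [cube_diam Q <= dist_compl U Q] in a form without infimum, which is
    plainly inherited by smaller cubes inside [Q]. *)
Definition far_cube Q : Prop :=
  forall x y, closed_cube Q x -> ~ U y -> cube_diam Q <= enorm (x - y).

Lemma far_cube_sub Q Q' : closed_cube Q' `<=` closed_cube Q -> Q'.2 <= Q.2 ->
  far_cube Q -> far_cube Q'.
Proof.
move=> QQ' s fQ x y /QQ' xQ Uy; apply: le_trans (fQ x y xQ Uy).
by rewrite /cube_diam ler_wpM2l ?sqrtr_ge0.
Qed.

(** Being far passes to children, so testing the parent is enough for maximality.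
    The parent being too close is also what bounds the distance by 4 diameters: 2 to
    reach a point of the parent, 2 more to leave [U]. *)
Definition maximal_far_cubes : set ('rV[R]_n * R) :=
  [set Q | exists k (z : cell_index n k.+1),
     [/\ Q = cell M z, far_cube (cell M z) & ~ far_cube (cell M (parent z))]].

(** Of two overlapping dyadic cubes the smaller lies in the larger. If it is strictly
    smaller, so does its parent, which is then far, against maximality. *)
Lemma maximal_far_cubes_disjoint Q Q' : maximal_far_cubes Q -> maximal_far_cubes Q' ->
  Q <> Q' -> open_cube Q `&` open_cube Q' = set0.
Proof.
have main k l (z : cell_index n k.+1) (z' : cell_index n l.+1) : (k <= l)%N ->
    far_cube (cell M z) -> ~ far_cube (cell M (parent z')) ->
    open_cube (cell M z) `&` open_cube (cell M z') !=set0 -> cell M z = cell M z'.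
  rewrite leq_eqVlt => /orP[/eqP kl|kl] fz nfz' meet.
    by subst l; rewrite (overlapping_cells_eq meet).
  case: nfz'; move: z' meet; rewrite -(subnK kl) => z' [x [xz xz']].
  apply: far_cube_sub fz.
    by apply: nested_cells; exists x; split=> //; exact: open_cell_parent.
  rewrite /= (mesh_pow M k.+1 (l - k.+1)) ler_peMl ?(mesh_ge0 M0) //.
  by rewrite exprn_ege1 // ler1n.
move=> [k [z [-> fz nfz]]] [l [z' [-> fz' nfz']]] ne.
apply: contrapT => /eqP/set0P meet; apply: ne.
have [kl|/ltnW lk] := leqP k l; first exact: main nfz' meet.
by apply/esym; apply: main lk fz' nfz _; rewrite setIC.
Qed.

Hypothesis oU : open U.
Hypothesis n0 : (0 < n)%N.
Let i0 : 'I_n := Ordinal n0.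

Let sqrt_n0 : 0 < Num.sqrt (n%:R : R).
Proof. by rewrite sqrtr_gt0 ltr0n. Qed.

Lemma outside_point : ~ U (const_mx M).
Proof.
move=> /UM; apply/negP; rewrite -leNgt -[leLHS](ger0_norm (ltW M0)).
by have := coord_le_norm (const_mx M : 'rV[R]_n) i0; rewrite mxE.
Qed.

Lemma far_cube_inside Q : 0 < Q.2 -> far_cube Q -> closed_cube Q `<=` U.
Proof.
move=> Q0 fQ x xQ; apply: contrapT => Ux; have := fQ x x xQ Ux.
by rewrite subrr enorm0 leNgt /cube_diam mulr_gt0.
Qed.

(** This starts the search for maximal cubes: the single cell of level 0 contains
    the corner [(M, ..., M)], which is outside [U]. *)
Lemma root_cell_not_far (z : cell_index n 0) : ~ far_cube (cell M z).
Proof.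
move=> /(_ (const_mx M) (const_mx M) _ outside_point).
rewrite subrr enorm0 leNgt /cube_diam mulr_gt0 ?(mesh_gt0 M0) // => H.
suff /H : closed_cube (cell M z) (const_mx M) by [].
move=> i; rewrite /= !mxE /node mesh0.
have : (z i : nat) = 0%N by case: (z i) => j /= /[!expn0]; case: j.
by have Mp := M0; move=> ->; rewrite mulr0; apply/andP; split; lra.
Qed.

Lemma small_cell_far x : U x -> exists k, forall z : cell_index n k,
  closed_cube (cell M z) x -> far_cube (cell M z).
Proof.
move=> Ux; have /nbhs_ballP[e /= e0 eU] := open_nbhs_nbhs (conj oU Ux).
have [k /(_ k (leqnn k)) Hk] := mesh_small M0 (divr_gt0 e0 (mulr_gt0 (ltr0n R 2) sqrt_n0)).
exists k => z xz p y pz Uy; rewrite /cube_diam /=.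
have exy : e <= enorm (x - y).
  apply: le_trans (norm_le_enorm _); rewrite leNgt; apply/negP => xy; apply: Uy.
  by apply: eU; rewrite -ball_normE.
have dxp : enorm (x - p) <= Num.sqrt n%:R * mesh M k.
  apply: enorm_le; first exact: mesh_ge0.
  move=> i; have := xz i; have := pz i; rewrite /= !mxE => /andP[? ?] /andP[? ?].
  by rewrite ler_norml; apply/andP; split; lra.
have := enorm_distD p x y; move: Hk; rewrite ltr_pdivlMr ?mulr_gt0 //; lra.
Qed.

Lemma maximal_far_cubes_whitney : whitney_decomposition U maximal_far_cubes.
Proof.
have ne Q : 0 < Q.2 -> [set enorm (x - y) | x in closed_cube Q & y in ~` U] !=set0.
  move=> Q0; exists (enorm (Q.1 - const_mx M)); exists Q.1.
    by move=> i; rewrite lexx lerDl ltW.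
  by exists (const_mx M) => //; exact: outside_point.
split.
- by move=> _ [k [z [-> _ _]]]; exact: mesh_gt0.
- apply/seteqP; split=> [x [_ [k [z [-> fz _]]] xz]|x Ux].
    by apply: far_cube_inside fz _ xz; exact: mesh_gt0.
  pose P k := `[< exists z : cell_index n k, closed_cube (cell M z) x /\ far_cube (cell M z) >].
  have exP : exists k, P k.
    have [k Hk] := small_cell_far Ux; have [z xz] := locate_cell k Ux.
    by exists k; apply/asboolP; exists z; split=> //; exact: Hk.
  case: (ex_minnP exP) => [[|k]] /asboolP[z [xz fz]] minP; first by case: (root_cell_not_far fz).
  exists (cell M z) => //; exists k, z; split=> // fp.
  have : P k by apply/asboolP; exists (parent z); split=> //; exact: cell_parent xz.
  by move=> /minP; rewrite ltnn.
- exact: maximal_far_cubes_disjoint.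
- move=> _ [k [z [-> fz nfz]]]; have h0 := mesh_gt0 M0 k.+1.
  apply/andP; split.
    by apply: lb_le_inf; [exact: ne|move=> _ [x xz [y Uy <-]]; exact: fz].
  have [x [y [xp Uy xy]]] : exists x y, [/\ closed_cube (cell M (parent z)) x, ~ U y &
      enorm (x - y) < cube_diam (cell M (parent z))].
    apply: contrapT => H; apply: nfz => x y xp Uy; rewrite leNgt; apply/negP => xy.
    by apply: H; exists x, y.
  apply: (@le_trans _ _ (enorm (corner M z - y))).
    apply: ge_inf; last by exists (corner M z); [exact: corner_in|exists y].
    by exists 0 => _ [? _ [? _ <-]]; exact: enorm_ge0.
  apply: le_trans (enorm_distD x _ _) _.
  have : enorm (corner M z - x) <= Num.sqrt n%:R * mesh M k.
    apply: enorm_le; first exact: mesh_ge0.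
    move=> i; have := xp i; have := cell_parent M0 (corner_in M0 z) i.
    by rewrite /= !mxE => /andP[? ?] /andP[? ?]; rewrite ler_norml; apply/andP; split; lra.
  by move: xy; rewrite /cube_diam /= [mesh M k]meshS; lra.
Qed.

End Whitney.

(** Dimension 0 is apart because diameters vanish there, so being far does not keep a
    cube inside [U]; but any cube is then the whole space. *)
Lemma whitney_dim0 (R : realType) (U : set 'rV[R]_0) :
  exists D, whitney_decomposition U D.
Proof.
have all0 (x y : 'rV[R]_0) : x = y by apply/rowP; case.
have [[u Uu]|U0] := pselect (U !=set0); last first.
  exists set0; split=> //; rewrite bigcup_set0; apply/seteqP; split=> // x Ux.
  by apply: U0; exists x.
exists [set (0, 1)]; split.
- by move=> _ ->.
- by rewrite bigcup_set1; apply/seteqP; split=> x _; [rewrite (all0 x u)|case].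
- by move=> _ _ -> -> /(_ erefl).
- move=> _ ->; rewrite /cube_diam sqrtr0 mul0r mulr0 /dist_compl.
  rewrite (_ : [set _ | _ in _ & _ in _] = set0) ?inf0 ?lexx //.
  by apply/seteqP; split=> // r [x _ [y Uy _]]; case: Uy; rewrite (all0 y u).
Qed.

Lemma whitney_exists (R : realType) (n : nat) (U : set 'rV[R]_n) :
  bounded_set U -> open U -> exists D, whitney_decomposition U D.
Proof.
case: n U => [|n] U; first by move=> _ _; exact: whitney_dim0.
move=> [N [_ UN]] oU.
pose M : R := `|N| + 2; have M0 : 0 < M by rewrite ltr_wpDl.
exists (maximal_far_cubes M U); apply: maximal_far_cubes_whitney => // x Ux.
apply: (@le_lt_trans _ _ (`|N| + 1)); last by rewrite ltrD2l ltr1n.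
by apply: UN Ux; rewrite (le_lt_trans (ler_norm N)) // ltrDl.
Qed.

(** * Uniqueness of the integral and the chain of an open set *)

Section IntegralUnique.
Variables (R : realType) (n : nat).
Implicit Types (f : 'rV[R]_n -> R) (Q : 'rV[R]_n * R).

(** The dyadic grid of the box [[-s/2, s/2]], with [s] the side of [Q], translated
    to [Q] and tagged at lower corners. *)
Lemma fine_partition Q (d : R) : 0 < Q.2 -> 0 < d ->
  exists m P, exists t : {ffun 'I_n -> 'I_m} -> 'rV[R]_n,
    [/\ grid_partition Q.1 (Q.1 + const_mx Q.2) m P, tags_in_cells P t &
        forall i j, (j < m)%N -> P i j.+1 - P i j < d].
Proof.
move=> Q0 d0; have [N /(_ N (leqnn N))] := mesh_small (divr_gt0 Q0 (ltr0n R 2)) d0.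
have half2 : 2 * (Q.2 / 2) = Q.2 by rewrite mulrC divfK.
have q0 := mesh_gt0 (divr_gt0 Q0 (ltr0n R 2)) N.
have qm : mesh (Q.2 / 2) N * (2 ^ N)%:R = Q.2.
  by rewrite /mesh half2 natrX divfK // lt0r_neq0 // exprn_gt0.
move: (mesh _ _) q0 qm => h h0 hm hd.
have PS (x : R) (j : nat) : x + h * j.+1%:R = x + h * j%:R + h.
  by rewrite -natr1 mulrDr mulr1 addrA.
exists (2 ^ N)%N, (fun i j => Q.1 0 i + h * j%:R),
  (fun c : {ffun 'I_n -> 'I_(2 ^ N)} => \row_i (Q.1 0 i + h * (c i)%:R)).
split=> [i|c i|i j _].
- by split=> [||j _]; rewrite ?mulr0 ?addr0 ?hm ?mxE // PS lerDl ltW.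
- by rewrite mxE lexx PS lerDl ltW.
- by rewrite PS addrAC subrr add0r.
Qed.

Lemma riemann_integral_unique f Q (v v' : R) : 0 < Q.2 ->
  has_riemann_integral f Q.1 (Q.1 + const_mx Q.2) v ->
  has_riemann_integral f Q.1 (Q.1 + const_mx Q.2) v' -> v = v'.
Proof.
move=> Q0 Hv Hv'; apply/eqP; rewrite -subr_eq0 -normr_le0.
apply/ler_addgt0Pr => e e0; rewrite add0r.
have e2 : 0 < e / 2 by rewrite divr_gt0.
have [d d0 Hd] := Hv _ e2; have [d' d'0 Hd'] := Hv' _ e2.
have dd' : 0 < Num.min d d' by rewrite lt_min d0.
have [m [P [t [gP tP Pd]]]] := fine_partition Q0 dd'.
have {}Hd : `|riemann_sum f P t - v| < e / 2.
  by apply: Hd => // i j /(Pd i); rewrite lt_min => /andP[].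
have {}Hd' : `|riemann_sum f P t - v'| < e / 2.
  by apply: Hd' => // i j /(Pd i); rewrite lt_min => /andP[].
have := ler_distD (riemann_sum f P t) v v'; rewrite (distrC v (riemann_sum f P t)); lra.
Qed.

Lemma has_sum_unique (T : choiceType) (D : set T) (g g' : T -> R) (v v' : R) :
  (forall x, D x -> g x = g' x) -> has_sum D g v -> has_sum D g' v' -> v = v'.
Proof.
move=> gg' Hv Hv'; apply/eqP; rewrite -subr_eq0 -normr_le0.
apply/ler_addgt0Pr => e e0; rewrite add0r.
have e2 : 0 < e / 2 by rewrite divr_gt0.
have [F [fF FD HF]] := Hv _ e2; have [F' [fF' FD' HF']] := Hv' _ e2.
have fU : finite_set (F `|` F') by rewrite finite_setU.
have UD : F `|` F' `<=` D by move=> x [/FD|/FD'].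
have := HF _ fU (@subsetUl _ _ _) UD; have := HF' _ fU (@subsetUr _ _ _) UD.
have -> : \sum_(x \in F `|` F') g x = \sum_(x \in F `|` F') g' x.
  by apply: eq_fsbigr => x /set_mem/UD/gg'.
move: (\sum_(x \in _) _) => S.
have := ler_distD S v v'; rewrite (distrC v S); lra.
Qed.

Lemma has_riemann_integral_open_unique (U : set 'rV[R]_n) f (v v' : R) :
  has_riemann_integral_open U f v -> has_riemann_integral_open U f v' -> v = v'.
Proof.
move=> [[D DU] Hv] [_ Hv'].
have [I HI sI] := Hv D DU; have [I' HI' sI'] := Hv' D DU; have [D0 _ _ _] := DU.
apply: has_sum_unique sI sI' => Q DQ.
by apply: riemann_integral_unique (D0 Q DQ) (HI Q DQ) (HI' Q DQ).
Qed.

End IntegralUnique.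

(** The cubes of a Whitney decomposition lie in [U], hence in the base box, where
    the results on grids apply to them. *)
Lemma inner_limit_integral (R : realType) (n : nat) (M : R) (M0 : 0 < M)
    (U : set 'rV[R]_n) (w : {scalar dirac_chain R n n}) :
  (forall x, U x -> `|x| < M) -> bounded_set U -> open U -> bounded_lipschitz w ->
  has_riemann_integral_open U (top_coeff w) (chain_integral (inner_limit M0 U) w).
Proof.
move=> UM bU oU bw; split=> [|D [D0 DU DI _]]; first exact: whitney_exists.
have DM Q : D Q -> in_base M Q.
  move=> DQ; have Q0 := D0 Q DQ.
  have inU x : closed_cube Q x -> `|x| < M by move=> xQ; apply: UM; rewrite -DU; exists Q.
  have lo : closed_cube Q Q.1 by move=> i; rewrite lexx lerDl ltW.
  have hi : closed_cube Q (Q.1 + const_mx Q.2) by move=> i; rewrite !mxE lexx lerDl ltW.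
  move=> i; have := le_lt_trans (coord_le_norm _ i) (inU _ lo).
  have := le_lt_trans (coord_le_norm _ i) (inU _ hi).
  by rewrite !mxE !ltr_norml => /andP[? ?] /andP[? ?]; split; apply: ltW.
exists (fun Q => chain_integral (inner_limit M0 (closed_cube Q)) w) => [Q DQ|].
  by apply: riemann_integral_cube => //; [exact: D0|exact: DM].
exact: has_sum_cubes.
Qed.

Theorem theorem2p10p2 (R : realType) (n : nat) (U : set 'rV[R]_n)
    (bU : bounded_set U) (oU : open U) :
  exists! J : differential_chain R n n,
    forall w : {scalar dirac_chain R n n}, bounded_lipschitz w ->
      has_riemann_integral_open U (top_coeff w) (chain_integral J w).
Proof.
have [M M0 UM] : exists2 M : R, 0 < M & forall x, U x -> `|x| < M.
  have [N [_ UN]] := bU; exists (`|N| + 2) => [|x Ux]; first by rewrite ltr_wpDl.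
  apply: (@le_lt_trans _ _ (`|N| + 1)); last by rewrite ltrD2l ltr1n.
  by apply: UN Ux; rewrite (le_lt_trans (ler_norm N)) // ltrDl.
exists (inner_limit M0 U); split=> [w bw|J HJ]; first exact: inner_limit_integral.
apply: chain_separation => w bw.
apply: has_riemann_integral_open_unique (HJ w bw).
exact: inner_limit_integral.
Qed.
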